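(* For every integer $d\ge 1$ there is a constant $C_d>0$, depending only on $d$, such that the following holds. Let $K$ be any field, let $m\ge 1$, let $V_1,\ldots,V_d$ be finite-dimensional $K$-vector spaces, and let $\underline{t}=(t_1,\ldots,t_m)\in(V_1\otimes\cdots\otimes V_d)^m$ be a tuple of tensors whose border collective partition rank is $\underline{\mathrm{prk}}(\underline{t})=r<\infty$. If $K$ is infinite, then $\mathrm{prk}_K(\underline{t})\le C_d\, m^3r^{d-1}$. If $K$ is finite, then $\mathrm{prk}_K(\underline{t})\le C_d\, m^3r^{d-1}\log(r+m)$. In particular, $\mathrm{prk}_K(\underline{t})$ is also bounded by a polynomial in $m$ and $\mathrm{prk}_{\overline{K}}(\underline{t})$: for every $d$ there is a polynomial $P_d$ in two variables such that $\mathrm{prk}_K(\underline{t})\le P_d(m,\mathrm{prk}_{\overline{K}}(\underline{t}))$ for all fields $K$, all integers $m\ge 1$, all finite-dimensional $K$-vector spaces $V_1,\ldots,V_d$ and all tuples $\underline{t}=(t_1,\ldots,t_m)\in(V_1\otimes\cdots\otimes V_d)^m$ with $\mathrm{prk}_{\overline{K}}(\underline{t})<\infty$, where $\overline{K}$ is an algebraic closure of $K$.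
   Context: Tensor products are over $K$. Write $[d]=\{1,\ldots,d\}$ and, for $I\subseteq[d]$, $V_I:=\bigotimes_{i\in I}V_i$ and $I^c:=[d]\setminus I$; identify $V_I\otimes V_{I^c}$ with $V_1\otimes\cdots\otimes V_d$ canonically. The partition rank $\mathrm{prk}_K(t)$ of $t\in V_1\otimes\cdots\otimes V_d$ is the minimal $r\ge 0$ in any expression $t=\sum_{i=1}^r a_i\otimes b_i$ where each $a_i\in V_{I_i}$ and $b_i\in V_{I_i^c}$ for some proper nonempty subset $I_i\subset[d]$ (and $\infty$ if there is no such expression). The collective partition rank $\mathrm{prk}_K(\underline{t})$ of $\underline{t}=(t_1,\ldots,t_m)$ is the minimum of $\mathrm{prk}_K(c_1t_1+\cdots+c_mt_m)$ over all $(c_1,\ldots,c_m)\in K^m\setminus\{(0,\ldots,0)\}$. $\mathrm{prk}_{\overline{K}}(\underline{t})$ is the same quantity over $\overline{K}$, after extending scalars of all $V_i$ to $\overline{K}$. The border collective partition rank $\underline{\mathrm{prk}}(\underline{t})$ is defined as follows. Choose bases so that $V_j=K^{n_j}$, and for $I\subseteq[d]$ let $\mathcal{T}_I$ be the affine space over $\mathbb{Z}$ with coordinates indexed by $\prod_{i\in I}\{1,\ldots,n_i\}$, so that $\mathcal{T}_I(K)=V_I$. Then $\underline{\mathrm{prk}}(\underline{t})$ is the minimal $r\ge 0$ such that there exist proper nonempty subsets $I_1,\ldots,I_r\subset[d]$ for which $\underline{t}$ is a $K$-point of the Zariski closure of the image of the morphism over $\mathbb{Z}$ $$\mathbb{A}^{m\times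 m}\times(\mathcal{T}_{[d]})^{m-1}\times\prod_{i=1}^r(\mathcal{T}_{I_i}\times\mathcal{T}_{I_i^c})\to(\mathcal{T}_{[d]})^m,$$ $$(g,(u_1,\ldots,u_{m-1}),((a_i,b_i))_i)\mapsto g\cdot\Big(u_1,\ldots,u_{m-1},\sum_{i=1}^r a_i\otimes b_i\Big),$$ where $g\cdot(p_1,\ldots,p_m)$ is the tuple whose $i$-th entry is $\sum_j g_{ij}p_j$ (and $\infty$ if there is no such $r$). The logarithm is to base $2$. *)

(* Defs.v *)
From HB Require Import structures.
From mathcomp Require Import all_boot all_order all_algebra.
From mathcomp Require Import mpoly boolp.

Set Implicit Arguments.
Unset Strict Implicit.
Unset Printing Implicit Defensive.

Import GRing.Theory.
Local Open Scope ring_scope.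

(* Least element of a set of naturals; [None] stands for infinity, the minimum
   of the empty set. *)
Definition min_nat (P : nat -> Prop) : option nat :=
  if pselect (exists r, `[< P r >]) is left exP then Some (ex_minn exP)
  else None.

Section Tensors.
Variables (d : nat) (n : 'I_d -> nat).

(* Bases are fixed: V_i = K^(n i), and a tensor in V_I is the array of its
   coordinates, indexed by the product of the 'I_(n i) for i in I. *)
Definition multi_index : finType := {dffun forall i : 'I_d, 'I_(n i)}.
Definition sub_index (I : {set 'I_d}) : finType :=
  {dffun forall i : {i : 'I_d | i \in I}, 'I_(n (val i))}.

(* K^o makes these K-modules under the pointwise operations. *)
Definition tensor (K : fieldType) := {ffun multi_index -> K^o}.
Definition sub_tensor (K : fieldType) (I : {set 'I_d}) :=
  {ffun sub_index I -> K^o}.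

Definition restrict (I : {set 'I_d}) (x : multi_index) : sub_index I :=
  [ffun i : {i : 'I_d | i \in I} => x (val i)].

(* a (x) b, under the identification of V_I (x) V_(I^c) with the whole tensor
   product. *)
Definition tprod (K : fieldType) (I : {set 'I_d})
    (a : sub_tensor K I) (b : sub_tensor K (~: I)) : tensor K :=
  [ffun x => a (restrict I x) * b (restrict (~: I) x)].

Definition proper_nonempty (I : {set 'I_d}) : Prop :=
  I != set0 /\ I != [set: 'I_d].

Section PartitionRank.
Variable K : fieldType.

Definition has_partition_expr (t : tensor K) (r : nat) : Prop :=
  exists (I : 'I_r -> {set 'I_d})
         (a : forall k, sub_tensor K (I k))
         (b : forall k, sub_tensor K (~: I k)),
    (forall k, proper_nonempty (I k)) /\
    t = \sum_(k < r) tprod (a k) (b k).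

Definition prk (t : tensor K) : option nat := min_nat (has_partition_expr t).

(* The values [None] of [prk] are infinite, hence irrelevant to the minimum. *)
Definition collective_prk (m : nat) (t : 'I_m -> tensor K) : option nat :=
  min_nat (fun r => exists c : 'rV[K]_m,
    c != 0 /\ prk (\sum_(i < m) c 0 i *: t i) = Some r).

End PartitionRank.

Definition extend_scalars (K L : fieldType) (iota : {rmorphism K -> L})
    (t : tensor K) : tensor L :=
  [ffun x => iota (t x)].

End Tensors.

(* The affine space over Z with coordinates indexed by a finite type T: its
   points are classes of field-valued points, and its closed subsets are the
   zero loci of sets of integer polynomials. *)
Section ZariskiClosure.
Variable T : finType.

Definition zeval (F : fieldType) (v : T -> F) (f : {mpoly int[#|T|]}) : F :=
  (map_mpoly intr f).@[fun k => v (enum_val k)].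

Definition in_zero_locus (S : {mpoly int[#|T|]} -> Prop)
    (F : fieldType) (v : T -> F) : Prop :=
  forall f, S f -> zeval v f = 0.

(* Here [X F v] says that the F-point v lies in the subset X.  The residue
   characteristic of F is arbitrary: the closure is taken over Z. *)
Definition in_zariski_closure (X : forall F : fieldType, (T -> F) -> Prop)
    (F : fieldType) (v : T -> F) : Prop :=
  forall S : {mpoly int[#|T|]} -> Prop,
    (forall (E : fieldType) (w : T -> E), X E w -> in_zero_locus S w) ->
    in_zero_locus S v.

End ZariskiClosure.

Section BorderRank.
Variables (d : nat) (n : 'I_d -> nat) (m : nat).

Definition tuple_coords (F : fieldType) (t : 'I_m -> tensor n F) :
    'I_m * multi_index n -> F :=
  fun ix => t ix.1 ix.2.

(* The tuple (u_1, ..., u_(m-1), s). *)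
Definition append_last (F : fieldType) (u : 'I_m.-1 -> tensor n F)
    (s : tensor n F) : 'I_m -> tensor n F :=
  fun j => oapp u s (insub (val j)).

Definition mx_act (F : fieldType) (g : 'M[F]_m) (p : 'I_m -> tensor n F) :
    'I_m -> tensor n F :=
  fun i => \sum_(j < m) g i j *: p j.

Definition border_image (r : nat) (I : 'I_r -> {set 'I_d})
    (F : fieldType) (v : 'I_m * multi_index n -> F) : Prop :=
  exists (g : 'M[F]_m) (u : 'I_m.-1 -> tensor n F)
         (a : forall k, sub_tensor n F (I k))
         (b : forall k, sub_tensor n F (~: I k)),
    v = tuple_coords
          (mx_act g (append_last u (\sum_(k < r) tprod (a k) (b k)))).

Definition border_prk (K : fieldType) (t : 'I_m -> tensor n K) : option nat :=
  min_nat (fun r => exists I : 'I_r -> {set 'I_d},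
    (forall k, proper_nonempty (I k)) /\
    in_zariski_closure (border_image I) (tuple_coords t)).

End BorderRank.

Definition is_algebraic_closure (K : fieldType) (L : closedFieldType)
    (iota : {rmorphism K -> L}) : Prop :=
  forall x : L, algebraicOver iota x.

(* Main.v *)
(* Let W = K^N, and let Y_w be the image of a tuple w of m tensors in the m-fold
   power of W (x) ... (x) W (d factors) under d matrices of indeterminates
   Phi_1, ..., Phi_d.

   If some nontrivial combination of w over a field E has partition rank at most r,
   then Y_w is parametrized quadratically by fewer variables than it has
   coordinates, as soon as N^d exceeds both N^(d-1) r and m by a constant factor;
   counting monomials, the coordinates of Y_w satisfy a nonzero polynomial of bounded
   degree. The existence of such a relation is a rank condition on a matrix of integer
   polynomials in w, so it passes to the Zariski closure over Z, and it descends along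
   field extensions.

   Conversely let h be a relation of minimal degree for t. Some partial derivative of
   h does not vanish on Y_t (in characteristic p, a relation in p-th powers gives one
   of smaller degree, because Frobenius preserves ranks of matrices), hence not at
   Phi = phi for some phi over K if K is large. The coefficients of h(Y_t(phi + Phi)) = 0
   at the monomials Phi_1(k_1, x_1) ... Phi_d(k_d, x_d), for fixed k and all x, express
   a nontrivial combination of the t_j as a sum of at most 2^d m N^(d-1) products.

   Over a small finite field, phi is found over an extension of degree logarithmic in
   the degree of h; restriction of scalars multiplies the rank by that degree. *)

Require Import Defs.
From HB Require Import structures.
From mathcomp Require Import all_boot all_order all_algebra fieldext.
From mathcomp Require Import mpoly boolp zify.

Set Implicit Arguments.
Unset Strict Implicit.
Unset Printing Implicit Defensive.

Import GRing.Theory Num.Theory.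
Local Open Scope ring_scope.

(** * Degrees and algebraic dependence *)

Section Degree.
Variables (k : nat) (R : idomainType).
Implicit Types p q : {mpoly R[k]}.

Lemma msizeM_leS p q a b :
  (msize p <= a.+1)%N -> (msize q <= b.+1)%N -> (msize (p * q) <= (a + b).+1)%N.
Proof.
have [->|nzp] := eqVneq p 0; first by rewrite mul0r msize0.
have [->|nzq] := eqVneq q 0; first by rewrite mulr0 msize0.
by rewrite msizeM // (mpolySpred mdeg nzp) (mpolySpred mdeg nzq); lia.
Qed.

Lemma msizeX_leS p a j : (msize p <= a.+1)%N -> (msize (p ^+ j) <= (a * j).+1)%N.
Proof.
move=> hp; elim: j => [|j IHj]; first by rewrite expr0 msize1.
by rewrite exprS mulnS msizeM_leS.
Qed.

Lemma msize_prod_leS (I : Type) (s : seq I) (P : pred I)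
    (F : I -> {mpoly R[k]}) (a : I -> nat) :
  (forall i, P i -> (msize (F i) <= (a i).+1)%N) ->
  (msize (\prod_(i <- s | P i) F i) <= (\sum_(i <- s | P i) a i).+1)%N.
Proof.
move=> hF; elim/big_rec2: _ => [|i y p Pi IH]; first by rewrite msize1.
exact: msizeM_leS (hF i Pi) IH.
Qed.

Lemma msize_sum_le (I : Type) (s : seq I) (P : pred I)
    (F : I -> {mpoly R[k]}) (a : nat) :
  (forall i, P i -> (msize (F i) <= a)%N) ->
  (msize (\sum_(i <- s | P i) F i) <= a)%N.
Proof.
move=> hF; elim/big_rec: _ => [|i p Pi IH]; first by rewrite msize0.
by apply: leq_trans (msizeD_le _ _) _; rewrite geq_max hF.
Qed.

Lemma msize_comp_le n e (lq : n.-tuple {mpoly R[k]}) (h : {mpoly R[n]}) :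
  (forall i, (msize (tnth lq i) <= e.+1)%N) ->
  (msize (h \mPo lq) <= (e * (msize h).-1).+1)%N.
Proof.
move=> hlq; rewrite comp_mpolyE big_seq.
apply: msize_sum_le => m /msize_mdeg_lt hm.
apply: leq_trans (msizeZ_le _ _) _.
apply: (@leq_trans (\sum_(i < n) e * m i).+1).
  by apply: msize_prod_leS => i _; apply: msizeX_leS.
rewrite -big_distrr /= -mdegE ltnS leq_mul2l; apply/orP; right.
by case: (msize h) hm.
Qed.

End Degree.

Lemma rowV_neq0P (F : fieldType) k (c : 'rV[F]_k) : c != 0 -> exists i, c 0 i != 0.
Proof.
move=> c0; apply/existsP; rewrite -negb_forall; apply: contra c0 => /forallP c0.
by apply/eqP/rowP => i; rewrite mxE; apply/eqP.
Qed.

Lemma not_row_freeP (F : fieldType) p q (A : 'M[F]_(p, q)) :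
  ~~ row_free A <-> exists2 c : 'rV_p, c != 0 & c *m A = 0.
Proof.
rewrite -kermx_eq0; split=> [/rowV0Pn[c /sub_kermxP cA c0]|[c c0 cA]].
  by exists c.
by apply/rowV0Pn; exists c => //; apply/sub_kermxP.
Qed.

Section Dependence.
Variable F : fieldType.

(** The columns cover all supports, so a nonzero vector of the left kernel is the same as a
    nontrivial linear relation; dependence becomes a rank condition. *)
Lemma linear_dependenceP k (T S : finType) (f : T -> {mpoly F[k]})
    (col : S -> 'X_{1..k}) :
  (forall x m, m \in msupp (f x) -> exists s, col s = m) ->
  ~~ row_free (\matrix_(i < #|T|, j < #|S|) (f (enum_val i))@_(col (enum_val j)))
  <-> exists c : T -> F, (exists x, c x != 0) /\ \sum_x c x *: f x = 0.
Proof.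
move=> hcol; rewrite not_row_freeP; split=> [[c c0 cA]|[c [[x cx] cf]]].
  exists (fun x => c 0 (enum_rank x)); split.
    by have [i ci] := rowV_neq0P c0; exists (enum_val i); rewrite enum_valK.
  apply/mpolyP => m; rewrite mcoeff0 raddf_sum /=.
  have [/existsP[x hx]|] := boolP [exists x, m \in msupp (f x)]; last first.
    move=> /existsPn hm; apply: big1 => x _.
    by rewrite mcoeffZ (memN_msupp_eq0 (hm x)) mulr0.
  have [s hs] := hcol x m hx.
  have := congr1 (fun r : 'rV_ _ => r 0 (enum_rank s)) cA.
  rewrite !mxE => cA0; rewrite -[RHS]cA0.
  rewrite [LHS](reindex _ (onW_bij _ (@enum_val_bij T))) /=.
  by apply: eq_bigr => i _; rewrite mxE !enum_rankK mcoeffZ hs enum_valK.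
exists (\row_i c (enum_val i)).
  apply: contraNneq cx => /rowP/(_ (enum_rank x)).
  by rewrite !mxE enum_rankK => ->.
apply/rowP => j; rewrite !mxE.
have := congr1 (mcoeff (col (enum_val j))) cf.
rewrite mcoeff0 raddf_sum /= => cf0; rewrite -[RHS]cf0.
rewrite [RHS](reindex _ (onW_bij _ (@enum_val_bij T))) /=.
by apply: eq_bigr => i _; rewrite !mxE mcoeffZ.
Qed.

Lemma mcoeff_sum_inj (T : finType) k (mon : T -> 'X_{1..k}) (c : T -> F) x :
  injective mon -> (\sum_y c y *: 'X_[F, mon y])@_(mon x) = c x.
Proof.
move=> mon_inj; rewrite raddf_sum (bigD1 x) //= mcoeffZ mcoeffX eqxx mulr1.
rewrite big1 ?addr0 // => y yx.
by rewrite mcoeffZ mcoeffX (inj_eq mon_inj) (negPf yx) mulr0.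
Qed.

(** For a nonzero polynomial [msize] is the degree plus one, so [b] is a strict bound on the degree
    of the relation. *)
Definition dependent M k (lq : M.-tuple {mpoly F[k]}) (b : nat) :=
  exists h : {mpoly F[M]}, [/\ h != 0, (msize h <= b)%N & h \mPo lq = 0].

Lemma dependent_sum M k (lq : M.-tuple {mpoly F[k]}) b (T : finType)
    (mon : T -> 'X_{1..M}) (c : T -> F) x :
  injective mon -> (forall y, mdeg (mon y) < b)%N -> c x != 0 ->
  \sum_y c y *: ('X_[mon y] \mPo lq) = 0 -> dependent lq b.
Proof.
move=> mon_inj hmon cx sum0; exists (\sum_y c y *: 'X_[F, mon y]); split.
- by apply: contraNneq cx => h0; rewrite -(mcoeff_sum_inj c x mon_inj) h0 mcoeff0.
- apply: msize_sum_le => y _; apply: leq_trans (msizeZ_le _ _) _.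
  by rewrite msizeX.
- by rewrite -[RHS]sum0 raddf_sum /=; apply: eq_bigr => y _; rewrite comp_mpolyZ.
Qed.

(* More monomials than the dimension of the space that contains their
   values. *)
Lemma dependent_count M k B e (lq : M.-tuple {mpoly F[k]}) :
  (0 < M)%N -> (0 < e)%N -> (forall i, (msize (tnth lq i) <= e.+1)%N) ->
  ((e * M * B) ^ k < B ^ M)%N -> dependent lq (M * B).
Proof.
move=> M0 e0 hlq hB.
have B0 : (0 < B)%N by case: B hB => //; rewrite exp0n.
(* Exponents range over boxes instead of simplices, which makes both numbers of monomials plain
   powers. *)
pose rows : finType := {ffun 'I_M -> 'I_B}.
pose cols : finType := {ffun 'I_k -> 'I_(e * M * B)}.
pose mon (a : rows) : 'X_{1..M} := [multinom (a i : nat) | i < M].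
pose col (b : cols) : 'X_{1..k} := [multinom (b i : nat) | i < k].
have deg_mon a : (mdeg (mon a) <= M * B.-1)%N.
  rewrite mdegE (eq_bigr (fun i => (a i : nat))); last by move=> i _; rewrite mnmE.
  rewrite -[X in (_ <= X * _)%N]card_ord -sum_nat_const; apply: leq_sum => i _.
  by rewrite -ltnS prednK.
have mon_inj : injective mon.
  move=> a b /mnmP ab; apply/ffunP => i; apply: val_inj.
  by have := ab i; rewrite !mnmE.
have hcol (a : rows) m :
    m \in msupp ('X_[F, mon a] \mPo lq) -> exists s, col s = m.
  move=> /msize_mdeg_lt hm.
  have m_lt i : (m i < e * M * B)%N.
    have le1 : (m i <= mdeg m)%N by rewrite mdegE (bigD1 i) //= leq_addr.
    have := leq_trans hm (msize_comp_le _ hlq); rewrite ltnS msizeX /= => le2.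
    have le3 : (e * mdeg (mon a) <= e * (M * B.-1))%N by rewrite leq_mul2l deg_mon orbT.
    apply: leq_ltn_trans (leq_trans le1 (leq_trans le2 le3)) _.
    by rewrite -mulnA !ltn_mul2l e0 M0 /= ltn_predL.
  by exists [ffun i => Ordinal (m_lt i)]; apply/mnmP => i; rewrite mnmE ffunE.
have : ~~ row_free (\matrix_(i < #|rows|, j < #|cols|)
    ('X_[F, mon (enum_val i)] \mPo lq)@_(col (enum_val j))).
  rewrite -row_leq_rank -ltnNge; apply: leq_ltn_trans (rank_leq_col _) _.
  by rewrite !card_ffun !card_ord.
move=> /(linear_dependenceP hcol)[c [[x cx] sum0]].
apply: dependent_sum mon_inj _ cx sum0 => y.
by apply: leq_ltn_trans (deg_mon y) _; rewrite ltn_mul2l M0 ltn_predL.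
Qed.

End Dependence.

(** * Relations of minimal degree *)

Lemma comp_mpoly_sum (R : nzRingType) n k (lq : n.-tuple {mpoly R[k]}) (I : Type)
    (s : seq I) (P : pred I) (f : I -> {mpoly R[n]}) :
  (\sum_(i <- s | P i) f i) \mPo lq = \sum_(i <- s | P i) (f i \mPo lq).
Proof. exact: raddf_sum. Qed.

(** The columns contain every monomial that the row monomials produce when the entries of [lq] have
    degree at most [e]. *)
Definition dependence_mx (R : comNzRingType) M k e b (lq : M.-tuple {mpoly R[k]}) :=
  \matrix_(i < #|{: 'X_{1..M < b}}|, j < #|{: 'X_{1..k < (e * b).+1}}|)
    ('X_[R, enum_val i] \mPo lq)@_(enum_val j).

(** Applied to field extensions, to Frobenius and to the evaluation of integer polynomials. *)
Lemma map_dependence_mx (R S : comNzRingType) (f : {rmorphism R -> S}) M k e b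
    (lq : M.-tuple {mpoly R[k]}) :
  map_mx f (dependence_mx e b lq) = dependence_mx e b (map_tuple (map_mpoly f) lq).
Proof.
apply/matrixP => i j; rewrite !mxE -mcoeff_map_mpoly !comp_mpolyX rmorph_prod /=.
by congr (_@_ _); apply: eq_bigr => l _; rewrite rmorphXn tnth_map.
Qed.

Lemma msize_mderiv_le (R : idomainType) k (p : {mpoly R[k]}) i :
  (msize (p^`M(i)) <= (msize p).-1)%N.
Proof.
rewrite /mderiv big_seq; apply: msize_sum_le => m hm; have [mi0|mi0] := posnP (m i).
  by rewrite mi0 mul0r scale0r msize0.
apply: leq_trans (msizeZ_le _ _) _; rewrite msizeX.
have := msize_mdeg_lt hm; rewrite -(@submK _ U_(i) m) ?lep1mP -?lt0n //.
by rewrite mdegD mdeg1 addmK; case: (msize p) => [|u] //=; lia.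
Qed.

Section MinimalDependence.
Variables (F : fieldType) (M k : nat).
Implicit Type lq : M.-tuple {mpoly F[k]}.

Lemma dependentP lq e b : (forall i, (msize (tnth lq i) <= e.+1)%N) ->
  ~~ row_free (dependence_mx e b lq) <-> dependent lq b.
Proof.
move=> hlq; have hcol (a : 'X_{1..M < b}) m :
    m \in msupp ('X_[F, a] \mPo lq) ->
    exists s : 'X_{1..k < (e * b).+1}, (s : 'X_{1..k}) = m.
  move=> /msize_mdeg_lt hm.
  have m_lt : (mdeg m < (e * b).+1)%N.
    apply: leq_trans hm (leq_trans (msize_comp_le _ hlq) _).
    by rewrite msizeX ltnS leq_mul2l ltnW ?orbT // bmdeg.
  by exists (BMultinom m_lt).
split=> [/(linear_dependenceP hcol)[c [[x cx] sum0]]|[h [h0 hb hlq0]]].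
  by apply: dependent_sum _ _ cx sum0 => [|y]; [apply: val_inj|apply: bmdeg].
apply/(linear_dependenceP hcol); exists (fun a : 'X_{1..M < b} => h@_a); split.
  have hm := mlead_supp h0; have lt_b := leq_trans (msize_mdeg_lt hm) hb.
  by exists (BMultinom lt_b); rewrite -mcoeff_msupp.
rewrite -[RHS]hlq0 {2}(mpolywE hb) raddf_sum /=.
by apply: eq_bigr => a _; rewrite comp_mpolyZ.
Qed.

(** [h] is a polynomial [g] in the p-th powers of the variables. As [F] need not be perfect, no p-th
    roots of coefficients are taken: [g] is a relation for the tuple with Frobenius applied to its
    coefficients, and Frobenius preserves the rank of the dependence matrix. *)
Lemma dependent_pdiv lq p (h : {mpoly F[M]}) : p \in [pchar F] ->
  h != 0 -> (1 < msize h)%N -> h \mPo lq = 0 ->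
  (forall m i, m \in msupp h -> (p %| m i)%N) -> dependent lq (msize h).-1.
Proof.
move=> charp h0 h1 hlq0 hdvd.
have p_pr := pcharf_prime charp; have p0 := prime_gt0 p_pr; have p1 := prime_gt1 p_pr.
have charP : p \in [pchar {mpoly F[k]}] by rewrite pchar_lalg.
pose e := \max_(i < M) msize (tnth lq i).
have he i : (msize (tnth lq i) <= e.+1)%N by apply: leqW; apply: (leq_bigmax i).
apply/(dependentP _ he).
rewrite -(row_free_map (pFrobenius_aut charp)) map_dependence_mx.
set lqp := map_tuple _ _.
(* In characteristic p, the p-th power acts on coefficients and variables separately. *)
have hp q : q ^+ p = map_mpoly (pFrobenius_aut charp) q \mPo [tuple 'X_i ^+ p | i < k].
  have hq := mpolyE q.
  rewrite {1}hq -(pFrobenius_autE charP) rmorph_sum /= [in RHS]hq.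
  rewrite [X in X \mPo _]raddf_sum [RHS]raddf_sum; apply: eq_bigr => m _ /=.
  rewrite map_mpolyZ map_mpolyX comp_mpolyZ comp_mpolyX !pFrobenius_autE.
  rewrite exprZn; congr (_ *: _).
  rewrite mpolyXE_id -prodrXl; apply: eq_bigr => i _.
  by rewrite tnth_mktuple exprAC.
have he' i : (msize (tnth lqp i) <= e.+1)%N.
  rewrite tnth_map; apply: leq_trans (he i); rewrite msizeE [leqRHS]msizeE.
  by rewrite (perm_big _ (msupp_map_mpoly _ (fmorph_inj _))).
apply/(dependentP _ he').
pose g := \sum_(m <- msupp h) h@_m *: 'X_[F, [multinom m i %/ p | i < M]]%N.
have hX m : m \in msupp h -> m = ([multinom m i %/ p | i < M] *+ p)%MM.
  by move=> hm; apply/mnmP => i; rewrite mulmnE mnmE divnK // hdvd.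
have hg : h = g \mPo [tuple 'X_i ^+ p | i < M].
  rewrite {1}[h]mpolyE raddf_sum /= big_seq [RHS]big_seq; apply: eq_bigr => m hm.
  rewrite comp_mpolyZ comp_mpolyX {2}(hX m hm) mpolyXE_id; congr (_ *: _).
  by apply: eq_bigr => i _; rewrite tnth_mktuple mulmnE mulnC exprM.
exists g; split.
- by apply: contraNneq h0 => g0; rewrite hg g0 comp_mpoly0.
- rewrite /g big_seq; apply: msize_sum_le => m hm; apply: leq_trans (msizeZ_le _ _) _.
  rewrite msizeX; have := msize_mdeg_lt hm; rewrite {1}(hX m hm) mdegMn.
  (* Division by [p] lowers every positive degree; the constant monomial is where [1 < msize h]
     enters. *)
  move: h1; case: (msize h) => [|[|s]] //= _.
  case: (mdeg _) => [|u] //; nia.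
(* Substituting ['X_i ^+ p] for each variable is injective, as it maps distinct monomials to
   distinct monomials. *)
- have hinj : injective (comp_mpoly [tuple 'X_i ^+ p | i < k] : {mpoly F[k]} -> _).
    apply: raddf_inj => q q0; apply/mpolyP => m.
    have /(congr1 (mcoeff (m *+ p)%MM)) : q \mPo [tuple 'X_i ^+ p | i < k] = 0 := q0.
    rewrite comp_mpolyEX raddf_sum /= !mcoeff0 => qm0; rewrite -[RHS]qm0.
    have hX' m' : 'X_[F, m'] \mPo [tuple 'X_i ^+ p | i < k] = 'X_[m' *+ p].
      rewrite comp_mpolyX mpolyXE_id; apply: eq_bigr => i _.
      by rewrite tnth_mktuple mulmnE mulnC exprM.
    have hmul m' : (m' *+ p == m *+ p)%MM = (m' == m).
      apply/eqP/eqP => [/mnmP mm|->//]; apply/mnmP => i.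
      by have := mm i; rewrite !mulmnE => /eqP; rewrite eqn_pmul2r // => /eqP.
    rewrite (eq_bigr (fun m' => q@_m' * (m' == m)%:R)); last first.
      by move=> m' _; rewrite mcoeffZ hX' mcoeffX hmul.
    have [hm|hm] := boolP (m \in msupp q); last first.
      rewrite (memN_msupp_eq0 hm) big_seq big1 // => m' hm'.
      by case: eqVneq hm' hm => [-> ->|]; rewrite ?mulr0.
    rewrite (bigD1_seq m) ?msupp_uniq //= eqxx mulr1 big1 ?addr0 // => m' mm'.
    by rewrite (negPf mm') mulr0.
  apply: hinj; rewrite comp_mpoly0 -hlq0 [in RHS]hg /g.
  rewrite [_ \mPo lqp]comp_mpoly_sum [LHS]comp_mpoly_sum.
  rewrite [X in X \mPo lq]comp_mpoly_sum comp_mpoly_sum; apply: eq_bigr => m _.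
  rewrite !comp_mpolyZ; congr (_ *: _).
  rewrite !comp_mpolyX !rmorph_prod /=; apply: eq_bigr => i _.
  by rewrite tnth_mktuple tnth_map !rmorphXn /= -hp comp_mpolyXU -tnth_nth.
Qed.

(** Take [h] of least degree. A partial derivative has smaller degree, so it is zero if it vanishes
    on [lq]. If all are zero, every exponent in [h] is zero in [F]; as [h] is not constant, this
    forces characteristic p and exponents divisible by p, against [dependent_pdiv]. *)
Lemma minimal_dependence lq (h0 : {mpoly F[M]}) : h0 != 0 -> h0 \mPo lq = 0 ->
  exists (h : {mpoly F[M]}) (i : 'I_M),
    [/\ h \mPo lq = 0, (msize h <= msize h0)%N & h^`M(i) \mPo lq != 0].
Proof.
move=> h00 hlq0.
have ex : exists s, `[< dependent lq s >].
  by exists (msize h0); apply/asboolP; exists h0.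
case: (ex_minnP ex) => s /asboolP[h [hn0 hs hlq]] smin.
have hmin g : g != 0 -> g \mPo lq = 0 -> (msize h <= msize g)%N.
  move=> g0 glq; apply: leq_trans hs (smin _ _); apply/asboolP.
  by exists g.
have hsize := hmin h0 h00 hlq0.
have [/existsP[i hi]|/existsPn hpart] := boolP [exists i, h^`M(i) \mPo lq != 0].
  by exists h, i.
have h1 : (1 < msize h)%N.
  rewrite ltnNge; apply/negP => /msize1_polyC hc; move: hlq hn0.
  by rewrite hc comp_mpolyC => /eqP; rewrite !mpolyC_eq0 => ->.
have hder i : h^`M(i) = 0.
  apply/eqP; apply: contraT => hi0.
  have := hmin _ hi0 (eqP (negbNE (hpart i))).
  suff : (msize (h^`M(i)) < msize h)%N by rewrite ltnNge => /negP.
  by rewrite -[X in (_ < X)%N]prednK ?(ltnW h1) // ltnS msize_mderiv_le.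
have hcoef m i : m \in msupp h -> (m i)%:R = 0 :> F.
  move=> hm; have [->//|mi0] := posnP (m i).
  have := congr1 (mcoeff (m - U_(i))%MM) (hder i).
  rewrite mcoeff_deriv mcoeff0 submK ?lep1mP -?lt0n // mnmBE mnm1E eqxx.
  rewrite subn1 prednK // -[h@_m *+ _]mulr_natr => /eqP; rewrite mulf_eq0 mcoeff_eq0 hm /=.
  by move=> /eqP.
have /existsP[[m hm] /= m0] : [exists m : seq_sub (msupp h), val m != 0%MM].
  apply: contraLR h1 => /existsPn supp0; rewrite -leqNgt msizeE.
  apply/bigmax_leqP_seq => m hm _; have := supp0 (SeqSub hm); rewrite negbK => /eqP /= ->.
  by rewrite mdeg0.
have [i mi] : exists i, m i != 0%N.
  apply/existsP; rewrite -negb_forall; apply: contra m0 => /forallP mi0.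
  by apply/eqP/mnmP => i; rewrite mnm0E; apply/eqP.
rewrite -lt0n in mi; have [p charp] := natf0_pchar mi (introT eqP (hcoef m i hm)).
have hdvd m' j : m' \in msupp h -> (p %| m' j)%N.
  by move=> hm'; rewrite (dvdn_pcharf charp) hcoef.
have [g [g0 gs glq]] := dependent_pdiv charp hn0 h1 hlq hdvd.
by have := leq_trans (hmin g g0 glq) gs; case: (msize h) h1 => //= u _; rewrite ltnn.
Qed.

End MinimalDependence.

(** * Points where a polynomial does not vanish *)

Section Nonvanishing.
Variable F : fieldType.

(** [muni] reads [p] as a univariate polynomial in the last variable, with coefficients in the
    others. *)
Lemma muni_coef k (p : {mpoly F[k.+1]}) (m : 'X_{1..k.+1}) :
  ((muni p)`_(m ord_max))@_[multinom m (widen_ord (leqnSn k) i) | i < k] = p@_m.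
Proof.
have hm m' : ((p@_m' *: 'X_[[multinom m' (widen_ord (leqnSn k) i) | i < k]]
      *: 'X^(m' ord_max))`_(m ord_max))@_[multinom m (widen_ord (leqnSn k) i) | i < k]
    = p@_m' * (m' == m)%:R.
  rewrite coefZ coefXn mulr_natr; case: eqVneq => [e|ne]; last first.
    rewrite mulr0n mcoeff0; case: (eqVneq m' m) ne => [->|_ _]; first by rewrite eqxx.
    by rewrite mulr0.
  rewrite mulr1n mcoeffZ mcoeffX; congr (_ * _%:R); congr nat_of_bool.
  apply/eqP/eqP => [/mnmP h|->//]; apply/mnmP => i.
  have [j ->|->] := unliftP ord_max i; last by rewrite e.
  have := h j; rewrite !mnmE (_ : widen_ord (leqnSn k) j = lift ord_max j) //.
  by apply: val_inj; rewrite /= /bump leqNgt ltn_ord.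
rewrite muniE coef_sum raddf_sum /= (eq_bigr _ (fun m' _ => hm m')).
have [hp|hp] := boolP (m \in msupp p); last first.
  rewrite (memN_msupp_eq0 hp) big_seq big1 // => m' hm'.
  by case: eqVneq hm' hp => [-> ->|]; rewrite ?mulr0.
rewrite (bigD1_seq m) ?msupp_uniq //= eqxx mulr1 big1 ?addr0 // => m' mm'.
by rewrite (negPf mm') mulr0.
Qed.

(** Induction on the number of variables: some coefficient with respect to the last variable is
    nonzero at a point of the others, and the univariate polynomial left there has fewer roots than
    [s] has elements. *)
Lemma exists_meval_neq0 k (p : {mpoly F[k]}) (s : seq F) :
  uniq s -> (msize p <= size s)%N -> p != 0 -> exists v, p.@[v] != 0.
Proof.
move=> uniq_s; elim: k p => [|k IHk] p hsize p0.
  exists (fun _ => 0); apply: contraNneq p0.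
  by rewrite {1 2}[p]nvar0_mpolyC mevalC => ->; rewrite mpolyC0.
have hm := mlead_supp p0; set m := mlead p in hm.
have hsize_m : (msize (muni p)`_(m ord_max) <= size s)%N.
  apply: leq_trans hsize; rewrite muniE coef_sum big_seq; apply: msize_sum_le => m' hm'.
  rewrite coefZ coefXn mulr_natr; case: eqP => _; last by rewrite mulr0n msize0.
  rewrite mulr1n; apply: leq_trans (msizeZ_le _ _) _; rewrite msizeX.
  apply: leq_trans (msize_mdeg_lt hm'); rewrite ltnS !mdegE big_ord_recr /=.
  by apply: leq_trans (leq_addr _ _); apply: leq_sum => i _; rewrite mnmE.
have coef_m : (muni p)`_(m ord_max) != 0.
  by apply: contraTneq hm => q0; rewrite mcoeff_msupp -muni_coef q0 mcoeff0 negbK.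
have [v hv] := IHk _ hsize_m coef_m.
pose q := map_poly (meval v) (muni p).
have q0 : q != 0.
  by apply: contraNneq hv => q0; rewrite -(coef_map_id0 _ _ (meval0 v)) -/q q0 coef0.
have [x hx] : exists x, q.[x] != 0.
  have /allPn[x _ hx] : ~~ all (root q) s.
    apply/negP => /(max_poly_roots q0)/(_ uniq_s); rewrite ltnNge => /negP; apply.
    apply: leq_trans hsize; apply: leq_trans (size_poly _ _) _.
    rewrite muniE; apply: leq_trans (size_sum _ _ _) _.
    apply/bigmax_leqP_seq => m' hm' _; apply: leq_trans (size_scale_leq _ _) _.
    rewrite size_polyXn; apply: leq_trans (msize_mdeg_lt hm').
    by rewrite ltnS mdegE (bigD1 ord_max) //= leq_addr.
  by exists x.
exists (fun i => oapp v x (unlift ord_max i)); apply: contraNneq hx => p_0.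
rewrite -p_0 mevalE /q muniE rmorph_sum /= horner_sum.
apply/eqP; apply: eq_bigr => m' _.
rewrite -mul_polyC rmorphM /= map_polyC map_polyXn /= hornerM hornerC hornerXn.
rewrite mevalZ mevalX -mulrA big_ord_recr /= unlift_none /=; congr (_ * (_ * _)).
apply: eq_bigr => i _; rewrite mnmE.
have -> : widen_ord (leqnSn k) i = lift ord_max i.
  by apply: val_inj; rewrite /= /bump leqNgt ltn_ord.
by rewrite liftK.
Qed.

End Nonvanishing.

(** * First-order expansion of a composition *)

Section Taylor.
Variables (R : comNzRingType) (M k : nat) (lq : M.-tuple {mpoly R[k]}).
Let c i := (tnth lq i)@_0%MM.
Let z i := tnth lq i - (c i)%:MP.

Let expandable (f : {mpoly R[M]}) := exists q : 'I_M -> {mpoly R[k]},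
  f \mPo lq = (f.@[c])%:MP + \sum_i z i * q i /\
  forall i, (q i)@_0%MM = (f^`M(i)).@[c].

Let z0 i : (z i)@_0%MM = 0.
Proof. by rewrite mcoeffB mcoeffC eqxx mulr1 subrr. Qed.

Let expandable_mcoeff0 f : expandable f -> (f \mPo lq)@_0%MM = f.@[c].
Proof.
move=> [q [-> _]]; rewrite mcoeffD mcoeffC eqxx mulr1 raddf_sum big1 ?addr0 //= => i _.
by rewrite (rmorphM (mcoeff 0%MM)) /= z0 mul0r.
Qed.

Let expandableC a : expandable a%:MP.
Proof.
exists (fun _ => 0); rewrite comp_mpolyC mevalC big1 ?addr0 => [|i _].
  by split=> // i; rewrite mcoeff0 mderivC meval0.
by rewrite mulr0.
Qed.

Let expandableD f g : expandable f -> expandable g -> expandable (f + g).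
Proof.
move=> [qf [hf hf0]] [qg [hg hg0]]; exists (fun i => qf i + qg i); split=> [|i].
  rewrite comp_mpolyD mevalD mpolyCD hf hg addrACA -big_split /=.
  by congr (_ + _); apply: eq_bigr => i _; rewrite mulrDr.
by rewrite mcoeffD hf0 hg0 mderivD mevalD.
Qed.

Let expandableM f g : expandable f -> expandable g -> expandable (f * g).
Proof.
move=> ef eg; have g0 := expandable_mcoeff0 eg.
case: ef eg => [qf [hf hf0]] [qg [hg hg0]].
exists (fun i => (f.@[c])%:MP * qg i + qf i * (g \mPo lq)); split=> [|i].
  rewrite rmorphM /= {1}hf mulrDl {1}hg mulrDr mevalM mpolyCM -addrA; congr (_ + _).
  rewrite mulr_sumr mulr_suml -big_split /=; apply: eq_bigr => i _.
  by rewrite [RHS]mulrDr mulrCA [z i * (qf i * _)]mulrA.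
rewrite mcoeffD !(rmorphM (mcoeff 0%MM)) /= hf0 hg0 g0 mcoeffC eqxx mulr1.
by rewrite mderivM mevalD !mevalM addrC.
Qed.

Let expandableX i : expandable 'X_i.
Proof.
exists (fun j => (j == i)%:R); split=> [|j].
  rewrite comp_mpolyXU -tnth_nth mevalXU (bigD1 i) //= eqxx mulr1 big1 ?addr0.
    by rewrite addrC subrK.
  by move=> j /negPf ->; rewrite mulr0.
rewrite mderivX mnm1E mevalZ eq_sym; case: eqVneq => [->|_] /=.
  rewrite (_ : U_(j) - U_(j) = 0)%MM ?mpolyX0 ?meval1 ?mcoeff1 ?eqxx ?mulr1 //.
  by apply/mnmP => l; rewrite mnmBE mnm0E subnn.
by rewrite mcoeff0 mul0r.
Qed.

(** Taylor expansion at the constant terms [c], the terms of higher order being absorbed in the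
    cofactors [q i]. The property holds for constants and variables and is stable under sums and
    products. *)
Lemma taylor2 f : exists q : 'I_M -> {mpoly R[k]},
  f \mPo lq = (f.@[c])%:MP + \sum_i z i * q i /\
  forall i, (q i)@_0%MM = (f^`M(i)).@[c].
Proof.
rewrite -/(expandable f) [f]mpolyE; elim/big_ind: _ => [||m _].
- by rewrite -mpolyC0; apply: expandableC.
- exact: expandableD.
rewrite -mul_mpolyC; apply: expandableM (expandableC _) _; rewrite mpolyXE_id.
elim/big_ind: _ => [||i _]; [by rewrite -mpolyC1; apply: expandableC|exact: expandableM|].
elim: (m i) => [|j IHj]; first by rewrite expr0 -mpolyC1; apply: expandableC.
by rewrite exprS; apply: expandableM (expandableX i) IHj.
Qed.

Lemma mcoeff0_comp f : (f \mPo lq)@_0%MM = f.@[c].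
Proof. by apply: expandable_mcoeff0; apply: taylor2. Qed.

End Taylor.

(** * Contractions with matrices *)

Section Contraction.
Variables (d : nat) (n : 'I_d -> nat).

Lemma notin_setC (I : {set 'I_d}) i : i \in I <> true -> i \in ~: I.
Proof. by rewrite in_setC => /negP. Qed.

Definition glue (I : {set 'I_d}) (x : sub_index n I) (y : sub_index n (~: I)) :
    multi_index n :=
  [ffun i : 'I_d => match Bool.bool_dec (i \in I) true with
    | left iI => x (exist _ i iI)
    | right iI => y (exist _ i (notin_setC iI))
    end].

Lemma restrict_glue I x y : restrict I (glue x y) = x.
Proof.
apply/ffunP => -[i iI]; rewrite !ffunE /=; case: Bool.bool_dec => [h|//].
by rewrite (bool_irrelevance h iI).
Qed.

Lemma restrict_glueC I x y : restrict (~: I) (glue x y) = y.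
Proof.
apply/ffunP => -[i iI]; rewrite !ffunE /=; case: Bool.bool_dec => [h|h].
  by have := iI; rewrite in_setC h.
by rewrite (bool_irrelevance (notin_setC h) iI).
Qed.

Lemma glue_restrict I v : glue (restrict I v) (restrict (~: I) v) = v.
Proof. by apply/ffunP => i; rewrite !ffunE; case: Bool.bool_dec => h; rewrite ffunE. Qed.

Variables (N : nat) (S : comNzRingType) (phi : forall i, 'I_N -> 'I_(n i) -> S).
Let nN : 'I_d -> nat := fun=> N.

(** The coordinate at [k] of the image of [t] under the tensor product of the linear maps with
    matrices [phi i], from rank [n i] to rank [N]. *)
Definition contract (t : multi_index n -> S) (k : multi_index nN) : S :=
  \sum_v t v * \prod_i phi (k i) (v i).

Definition sub_contract I (a : sub_index n I -> S) (k : sub_index nN I) : S :=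
  \sum_v a v * \prod_i phi (k i) (v i).

(** The tensor product of the maps splits along [I] and its complement, so partition expressions
    survive contraction with the same sets. *)
Lemma contract_mul I (a : sub_index n I -> S) (b : sub_index n (~: I) -> S) k :
  contract (fun v => a (restrict I v) * b (restrict (~: I) v)) k
  = sub_contract a (restrict I k) * sub_contract b (restrict (~: I) k).
Proof.
have glue_bij : bijective
    (fun p : sub_index n I * sub_index n (~: I) => glue p.1 p.2).
  exists (fun v => (restrict I v, restrict (~: I) v)) => [[x y]|v] /=.
    by rewrite restrict_glue restrict_glueC.
  exact: glue_restrict.
rewrite /contract (reindex _ (onW_bij _ glue_bij)) /=.
rewrite /sub_contract big_distrlr pair_bigA /=; apply: eq_bigr => -[x y] _ /=.
rewrite restrict_glue restrict_glueC mulrACA; congr (_ * _).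
rewrite (bigID (mem I)) /=; congr (_ * _).
  rewrite (big_sub (mem I)) /=; apply: eq_bigr => -[i iI] _.
  by rewrite -[in RHS](restrict_glue x y) !ffunE.
rewrite (eq_bigl (mem (~: I))) => [|i]; last by rewrite inE in_setC.
rewrite (big_sub (mem (~: I))) /=; apply: eq_bigr => -[i iI] _.
by rewrite -[in RHS](restrict_glueC x y) !ffunE.
Qed.

Lemma contract_sum (J : Type) (s : seq J) (P : pred J) (t : J -> multi_index n -> S) k :
  contract (fun v => \sum_(j <- s | P j) t j v) k = \sum_(j <- s | P j) contract (t j) k.
Proof.
rewrite /contract exchange_big /=; apply: eq_bigr => v _.
by rewrite mulr_suml.
Qed.

Lemma contractD t u k :
  contract (fun v => t v + u v) k = contract t k + contract u k.
Proof. by rewrite -big_split; apply: eq_bigr => v _; rewrite mulrDl. Qed.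

Lemma contractZ c t k : contract (fun v => c * t v) k = c * contract t k.
Proof. by rewrite /contract mulr_sumr; apply: eq_bigr => v _; rewrite mulrA. Qed.

End Contraction.

Lemma rmorph_contract (R S : comNzRingType) (f : {rmorphism R -> S}) d (n : 'I_d -> nat)
    N (phi : forall i, 'I_N -> 'I_(n i) -> R) t k :
  f (contract phi t k) = contract (fun i k v => f (phi i k v)) (fun v => f (t v)) k.
Proof.
rewrite /contract rmorph_sum; apply: eq_bigr => v _.
by rewrite rmorphM rmorph_prod.
Qed.

Lemma eq_contract (S : comNzRingType) d (n : 'I_d -> nat) N
    (phi psi : forall i, 'I_N -> 'I_(n i) -> S) t u k :
  (forall i k v, phi i k v = psi i k v) -> t =1 u -> contract phi t k = contract psi u k.
Proof.
move=> hphi htu; apply: eq_bigr => v _; rewrite htu; congr (_ * _).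
by apply: eq_bigr => i _; rewrite hphi.
Qed.

Section GenericContraction.
Variables (d : nat) (n : 'I_d -> nat) (N m : nat).

Definition mx_var : finType := {i : 'I_d & ('I_N * 'I_(n i))%type}.

Definition mx_entry i (k : 'I_N) (v : 'I_(n i)) : mx_var := Tagged _ (k, v).

Definition image_coord : finType := ('I_m * multi_index (fun _ : 'I_d => N))%type.

Definition generic_mx (R : comNzRingType) i (k : 'I_N) (v : 'I_(n i)) :
    {mpoly R[#|mx_var|]} :=
  'X_(enum_rank (mx_entry k v)).

(* The coordinates of the image of the tuple [w] under d generic linear maps to
   an N-dimensional space. *)
Definition generic_image (R : comNzRingType) (w : 'I_m * multi_index n -> R) :
    #|image_coord|.-tuple {mpoly R[#|mx_var|]} :=
  [tuple contract (@generic_mx R) (fun v => (w ((enum_val l).1, v))%:MP) (enum_val l).2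
    | l < #|image_coord|].

Lemma map_generic_image (R S : comNzRingType) (f : {rmorphism R -> S}) w :
  map_tuple (map_mpoly f) (generic_image w) = generic_image (f \o w).
Proof.
apply: eq_from_tnth => l; rewrite tnth_map !tnth_mktuple rmorph_contract.
by apply: eq_contract => [i k v|v] /=; rewrite ?map_mpolyX ?map_mpolyC.
Qed.

Lemma msize_generic_image (F : fieldType) (w : 'I_m * multi_index n -> F) l :
  (msize (tnth (generic_image w) l) <= d.+1)%N.
Proof.
rewrite tnth_mktuple; apply: msize_sum_le => v _; rewrite mul_mpolyC.
apply: leq_trans (msizeZ_le _ _) _.
apply: (@leq_trans (\sum_(i : 'I_d) 1).+1); last by rewrite sum1_card card_ord.
by apply: msize_prod_leS => i _; rewrite msizeX mdeg1.
Qed.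

End GenericContraction.

(** * Tuples of small collective partition rank are dependent *)

Lemma card_dffun_const (A : finType) N : #|{dffun forall _ : A, 'I_N}| = (N ^ #|A|)%N.
Proof.
rewrite card_dep_ffun [#|A|]cardE /image_mem.
by elim: (enum A) => //= _ s ->; rewrite card_ord expnS.
Qed.

Lemma card_coord d N m : #|image_coord d N m| = (m * N ^ d)%N.
Proof. by rewrite card_prod card_ord card_dffun_const card_ord. Qed.

Lemma card_sub_index d N (I : {set 'I_d}) :
  #|sub_index (fun _ : 'I_d => N) I| = (N ^ #|I|)%N.
Proof. by rewrite card_dffun_const card_sig; congr (_ ^ _)%N; apply: eq_card. Qed.

Lemma comp_mpolyA (R : comNzRingType) i j k (h : {mpoly R[i]}) (lq : i.-tuple {mpoly R[j]})
    (lr : j.-tuple {mpoly R[k]}) :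
  (h \mPo lq) \mPo lr = h \mPo [tuple tnth lq l \mPo lr | l < i].
Proof.
rewrite [h]mpolyE [X in X \mPo lr]comp_mpoly_sum [LHS]comp_mpoly_sum [RHS]comp_mpoly_sum.
apply: eq_bigr => m _; rewrite !comp_mpolyZ; congr (_ *: _).
rewrite !comp_mpolyX rmorph_prod; apply: eq_bigr => l _.
by rewrite rmorphXn tnth_mktuple.
Qed.

(** A relation survives every substitution; the tuples of low rank will be substitution instances of
    a dependent tuple. *)
Lemma dependent_comp (F : fieldType) i j k (lq : i.-tuple {mpoly F[j]})
    (lr : j.-tuple {mpoly F[k]}) b :
  dependent lq b -> dependent [tuple tnth lq l \mPo lr | l < i] b.
Proof.
by move=> [h [h0 hb hlq]]; exists h; split=> //; rewrite -comp_mpolyA hlq comp_mpoly0.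
Qed.

Definition has_collective_expr d (n : 'I_d -> nat) (F : fieldType) m
    (t : 'I_m -> tensor n F) (r : nat) :=
  exists c : 'rV[F]_m, c != 0 /\ has_partition_expr (\sum_(i < m) c 0 i *: t i) r.

Section LowRank.
Variables (d : nat) (n : 'I_d -> nat) (F : fieldType) (m : nat) (t : 'I_m -> tensor n F).
Variables (r N : nat).
Let nN : 'I_d -> nat := fun=> N.

(** Division by a nonzero coefficient of the combination. *)
Lemma has_collective_expr_solve : has_collective_expr t r ->
  exists (l : 'I_m) (c : 'I_m -> F) (I : 'I_r -> {set 'I_d})
      (a : forall k, sub_tensor n F (I k)) (b : forall k, sub_tensor n F (~: I k)),
    (forall k, proper_nonempty (I k)) /\
    forall v, t l v = \sum_(j | j != l) c j * t j v
      + \sum_(k < r) a k (restrict (I k) v) * b k (restrict (~: I k) v).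
Proof.
move=> [c [c0 [I [a [b [hI ht]]]]]]; have [l cl] := rowV_neq0P c0.
exists l, (fun j => - (c 0 l)^-1 * c 0 j), I.
exists (fun k => (c 0 l)^-1 *: a k), b; split=> // v.
have /(congr1 (fun u : tensor n F => u v)) := ht.
rewrite !sum_ffunE (bigD1 l) //= ffunE => /(canRL (addrK _)) /(canRL (mulKf cl)) ->.
rewrite mulrDr addrC mulrN !mulr_sumr -sumrN; congr (_ + _); apply: eq_bigr => k _.
  by rewrite ffunE !mulNr; congr (- _); apply: mulrA.
by rewrite !ffunE mulrA.
Qed.

(** The generic image factors through the quadratic polynomials [Q] in the parameters [T]. The
    exponent on the left bounds the number of parameters: a factor of a product lives on a proper
    subset, hence has at most [N ^ d.-1] coordinates. *)
Lemma dependent_low_rank B : (0 < m)%N -> (0 < N)%N -> has_collective_expr t r ->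
  ((2 * (m * N ^ d) * B) ^ (m + m.-1 * N ^ d + 2 * (r * N ^ d.-1)) < B ^ (m * N ^ d))%N ->
  dependent (generic_image N (tuple_coords t)) (m * N ^ d * B).
Proof.
move=> m0 N0 /has_collective_expr_solve[l [c [I [a [b [hI ht]]]]]] hB.
pose A1 : finType := {k : 'I_r & sub_index nN (I k)}.
pose A2 : finType := {k : 'I_r & sub_index nN (~: I k)}.
pose U : finType := ({j : 'I_m | j != l} * multi_index nN)%type.
(* The summands are the coefficients [c j], the coordinates of the images of the [t j] with
   [j != l], and those of the left and right factors of the products. *)
pose T : finType := (('I_m + U) + (A1 + A2))%type.
have cardT : (#|T| <= m + m.-1 * N ^ d + 2 * (r * N ^ d.-1))%N.
  rewrite !card_sum card_prod card_ord card_sig card_dffun_const card_ord.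
  have -> : #|[pred j : 'I_m | j != l]| = m.-1 by rewrite cardC1 card_ord.
  have card_le (J : 'I_r -> {set 'I_d}) : (forall k, J k != [set: 'I_d]) ->
      (#|{: {k : 'I_r & sub_index nN (J k)}}| <= r * N ^ d.-1)%N.
    move=> hJ; rewrite card_tagged sumnE big_map big_enum /=.
    rewrite -[X in (_ <= X * _)%N]card_ord -sum_nat_const; apply: leq_sum => k _.
    rewrite card_sub_index leq_pexp2l //.
    have : J k \proper [set: 'I_d] by rewrite properT.
    by move/proper_card; rewrite cardsT card_ord => hk; rewrite -ltnS (ltn_predK hk).
  rewrite mul2n -addnn leq_add2l leq_add // card_le // => k.
    by case: (hI k).
  by case: (hI k) => + _; apply: contraNneq => IT; rewrite -[I k]setCK IT setCT.
pose P j x : T := inl (inr (j, x)).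
pose PA k (x : sub_index nN (I k)) : T := inr (inl (Tagged (fun k => sub_index nN (I k)) x)).
pose PB k (x : sub_index nN (~: I k)) : T :=
  inr (inr (Tagged (fun k => sub_index nN (~: I k)) x)).
pose X (x : T) : {mpoly F[#|T|]} := 'X_(enum_rank x).
(* The coordinates of the tensors other than [t l] are parameters themselves; those of [t l] are
   quadratic. *)
pose Q (kx : image_coord d N m) : {mpoly F[#|T|]} :=
  if insub kx.1 is Some j then X (P j kx.2)
  else \sum_(j : {j | j != l}) X (inl (inl (val j))) * X (P j kx.2)
    + \sum_(k < r) X (PA k (restrict (I k) kx.2)) * X (PB k (restrict (~: I k) kx.2)).
pose phi := @generic_mx d n N F.
(* The values of the parameters that give back the generic image of [t]. *)
pose Z (x : T) : {mpoly F[#|mx_var n N|]} := match x with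
  | inl (inl j) => (c j)%:MP
  | inl (inr u) => contract phi (fun v => (t (val u.1) v)%:MP) u.2
  | inr (inl u) => sub_contract phi (fun v => (a (tag u) v)%:MP) (tagged u)
  | inr (inr u) => sub_contract phi (fun v => (b (tag u) v)%:MP) (tagged u)
  end.
have -> : generic_image N (tuple_coords t)
    = [tuple tnth [tuple Q (enum_val i) | i < #|image_coord d N m|] i
         \mPo [tuple Z (enum_val i) | i < #|T|] | i < #|image_coord d N m|].
  apply: eq_from_tnth => i; rewrite !tnth_mktuple /Q; case: (enum_val i) => j x /=.
  have XZ y : X y \mPo [tuple Z (enum_val i) | i < #|T|] = Z y.
    by rewrite comp_mpolyXU -tnth_nth tnth_mktuple enum_rankK.
  case: insubP => [u _ <-|]; first by rewrite XZ.
  rewrite negbK => /eqP ->; rewrite comp_mpolyD !comp_mpoly_sum /=.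
  transitivity (contract phi (fun v => \sum_(j | j != l) (c j)%:MP * (t j v)%:MP
      + \sum_(k < r) (a k (restrict (I k) v))%:MP * (b k (restrict (~: I k) v))%:MP) x).
    apply: eq_contract => // v; rewrite /tuple_coords /= ht mpolyCD !rmorph_sum /=.
    by congr (_ + _); apply: eq_bigr => k _; rewrite mpolyCM.
  rewrite contractD !contract_sum; congr (_ + _).
    rewrite (big_sub (fun j => j != l)); apply: eq_bigr => j' _.
    by rewrite contractZ rmorphM /= !XZ.
  by apply: eq_bigr => k _;
    rewrite (contract_mul phi (fun y => (a k y)%:MP) (fun y => (b k y)%:MP)) rmorphM /= !XZ.
rewrite -card_coord in hB *; apply: dependent_comp; apply: (dependent_count (e := 2)) => //.
- by rewrite card_coord muln_gt0 m0 expn_gt0 N0.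
- move=> i; rewrite tnth_mktuple /Q; case: insubP => [j _ _|_]; first by rewrite msizeX mdeg1.
  have XX x y : (msize (X x * X y) <= 3)%N.
    by apply: (msizeM_leS (a := 1) (b := 1)); rewrite msizeX mdeg1.
  apply: leq_trans (msizeD_le _ _) _; rewrite geq_max.
  by rewrite !msize_sum_le // => k _; apply: XX.
have B0 : (0 < B)%N.
  by case: (B) hB => //; rewrite exp0n // card_coord muln_gt0 m0 expn_gt0 N0.
apply: leq_ltn_trans hB; apply: leq_pexp2l cardT.
by rewrite card_coord !muln_gt0 m0 expn_gt0 N0 B0.
Qed.

End LowRank.

(** * Coefficients of squarefree monomials *)

Section SquarefreeCoefficients.
Variables (R : comNzRingType) (T : finType) (K : nat) (e : T -> 'I_K).
Hypothesis e_inj : injective e.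

Definition sqfree_mnm (S : {set T}) : 'X_{1..K} := (\sum_(i in S) U_(e i))%MM.

Lemma sqfree_mnmE S i : sqfree_mnm S (e i) = (i \in S).
Proof.
rewrite /sqfree_mnm mnm_sumE; have [iS|iS] := boolP (i \in S).
  rewrite (bigD1 i) //= mnm1E eqxx big1 ?addn0 // => j /andP[_ ji].
  by rewrite mnm1E (inj_eq e_inj) (negPf ji).
by rewrite big1 // => j jS; rewrite mnm1E (inj_eq e_inj); case: eqP jS iS => // -> ->.
Qed.

Lemma sqfree_mnm_out S j : j \notin codom e -> sqfree_mnm S j = 0%N.
Proof.
move=> hj; rewrite /sqfree_mnm mnm_sumE big1 // => i _; rewrite mnm1E.
by case: eqP hj => // <-; rewrite codom_f.
Qed.

Lemma sqfree_mnmP (S : {set T}) (m : 'X_{1..K}) :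
  (forall i, m (e i) = (i \in S)) -> (forall j, j \notin codom e -> m j = 0%N) ->
  m = sqfree_mnm S.
Proof.
move=> hS hout; apply/mnmP => j; have [/codomP[i ->]|hj] := boolP (j \in codom e).
  by rewrite hS sqfree_mnmE.
by rewrite hout // sqfree_mnm_out.
Qed.

Lemma sqfree_mnm_inj : injective sqfree_mnm.
Proof.
move=> S S' SS'; apply/setP => i; have := congr1 (fun m : 'X_{1..K} => m (e i)) SS'.
by rewrite !sqfree_mnmE; do 2 case: (i \in _).
Qed.

Lemma sqfree_mnm0 : sqfree_mnm set0 = 0%MM.
Proof. by rewrite /sqfree_mnm big_set0. Qed.

Lemma mdeg_sqfree S : mdeg (sqfree_mnm S) = #|S|.
Proof. by rewrite /sqfree_mnm mdeg_sum -sum1_card; apply: eq_bigr => i _; rewrite mdeg1. Qed.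

Lemma mdeg_sqfree_lt S : (mdeg (sqfree_mnm S) < (mdeg (sqfree_mnm setT)).+1)%N.
Proof. by rewrite !mdeg_sqfree ltnS cardsT max_card. Qed.

(** A squarefree monomial factors only into the monomials of a subset and of its complement. *)
Lemma mcoeffM_sqfree (f g : {mpoly R[K]}) :
  (f * g)@_(sqfree_mnm setT)
  = \sum_(S : {set T}) f@_(sqfree_mnm S) * g@_(sqfree_mnm (~: S)).
Proof.
rewrite mcoeffM (reindex_onto
  (fun S => (BMultinom (mdeg_sqfree_lt S), BMultinom (mdeg_sqfree_lt (~: S))))
  (fun k => [set i | (k.1 : 'X_{1..K}) (e i) != 0%N])) /=; last first.
  move=> [[k1 h1] [k2 h2]] /= /eqP/mnmP hk.
  have hk1 i : k1 (e i) = (k1 (e i) != 0%N).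
    have := hk (e i); rewrite sqfree_mnmE mnmDE inE.
    by case: (k1 (e i)) => [|[|u]].
  have hk2 i : k2 (e i) = (k1 (e i) == 0%N).
    have := hk (e i); rewrite sqfree_mnmE mnmDE inE hk1.
    by case: (k1 (e i)) => [|u] /=; [rewrite add0n|rewrite add1n => -[]].
  have hout j : j \notin codom e -> k1 j = 0%N /\ k2 j = 0%N.
    move=> hj; have := hk j; rewrite sqfree_mnm_out // mnmDE => /esym/eqP.
    by rewrite addn_eq0 => /andP[/eqP -> /eqP ->].
  congr (_, _); apply/val_inj/esym; apply: sqfree_mnmP => /= [i|j /hout[]//].
    by rewrite inE hk1; case: (k1 _).
  by rewrite inE in_set hk2 negbK.
apply: eq_bigl => S; apply/andP; split.
  apply/eqP/esym; apply: sqfree_mnmP => [i|j hj]; rewrite mnmDE.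
    by rewrite !sqfree_mnmE !inE; case: (i \in S).
  by rewrite !sqfree_mnm_out.
by apply/eqP/setP => i; rewrite inE sqfree_mnmE; case: (i \in S).
Qed.

End SquarefreeCoefficients.

(** * From a relation to a partition expression *)

Lemma has_partition_expr_set d (n : 'I_d -> nat) (F : fieldType) (u : tensor n F)
    (X : finType) (A : {set X}) (I : X -> {set 'I_d})
    (a : forall x, sub_tensor n F (I x)) (b : forall x, sub_tensor n F (~: I x)) :
  (forall x, x \in A -> proper_nonempty (I x)) ->
  u = \sum_(x in A) tprod (a x) (b x) -> has_partition_expr u #|A|.
Proof.
move=> hI ->; exists (fun k => I (enum_val k)), (fun k => a (enum_val k)).
exists (fun k => b (enum_val k)); split=> [k|]; first exact/hI/enum_valP.
by rewrite big_enum_val.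
Qed.

Section RankBound.
Variables (d : nat) (n : 'I_d -> nat) (F : fieldType) (N m : nat).
Variables (t : 'I_m -> tensor n F) (v : 'I_#|mx_var n N| -> F).
Let nN : 'I_d -> nat := fun=> N.
Variable k0 : multi_index nN.

(** A coordinate of the generic image after translation of the matrices by [v], so that expansion at
    [v] becomes expansion at 0. *)
Definition shifted_coord (l : image_coord d N m) : {mpoly F[#|mx_var n N|]} :=
  contract (fun i k x => generic_mx F k x + (v (enum_rank (@mx_entry d n N i k x)))%:MP)
    (fun x => (t l.1 x)%:MP) l.2.

(** For fixed [k] and [x], these are the d variables whose product is the monomial to be
    extracted. *)
Definition row_var (k : multi_index nN) (x : multi_index n) i :
    'I_#|mx_var n N| :=
  enum_rank (@mx_entry d n N i (k i) (x i)).

Lemma eq_mx_entry i (k k' : 'I_N) (x x' : 'I_(n i)) :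
  (mx_entry k x == mx_entry k' x') = (k == k') && (x == x').
Proof. by rewrite eq_Tagged. Qed.

Lemma row_var_eq k k' x x' i j :
  row_var k x i = row_var k' x' j -> [/\ i = j, k i = k' i & x i = x' i].
Proof.
move=> /enum_rank_inj h; have ij : i = j := congr1 tag h.
by move: h; rewrite -ij => /eqP; rewrite eq_mx_entry => /andP[/eqP -> /eqP ->].
Qed.

Lemma row_var_inj k x : injective (row_var k x).
Proof. by move=> i j /row_var_eq[]. Qed.

(** In the expanded product, [J] collects the factors that contribute a variable, its complement
    those that contribute an entry of [v]. *)
Lemma mcoeff_shifted_coord l mn : (shifted_coord l)@_mn
  = \sum_x \sum_(J : {set 'I_d}) t l.1 x * (\prod_(i in ~: J) v (row_var l.2 x i))
      * (sqfree_mnm (row_var l.2 x) J == mn)%:R.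
Proof.
rewrite raddf_sum; apply: eq_bigr => x _ /=; rewrite mcoeffCM.
rewrite bigA_distr raddf_sum mulr_sumr; apply: eq_bigr => J _ /=.
rewrite -mulrA; congr (_ * _).
transitivity ((\prod_(i in ~: J) (v (row_var l.2 x i))%:MP
  * 'X_[F, sqfree_mnm (row_var l.2 x) J])@_mn).
  congr (_@_ _); rewrite mulrC -mprodXE (bigID (mem J)) /=; congr (_ * _).
    by apply: eq_bigr => i /= ->.
  by apply: eq_big => i /=; rewrite ?in_setC // => /negPf ->.
by rewrite -rmorph_prod mcoeffCM mcoeffX.
Qed.

(** The coordinate [l] involves only the rows [l.2 i], so it produces no variable of another row
    [k0 i]. *)
Lemma shifted_coord_coef0 (l : image_coord d N m) (S : {set 'I_d}) x i : i \in S -> l.2 i != k0 i ->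
  (shifted_coord l)@_(sqfree_mnm (row_var k0 x) S) = 0.
Proof.
move=> iS ki; rewrite mcoeff_shifted_coord big1 // => y _; rewrite big1 // => J _.
case: eqP => [|_]; last by rewrite mulr0.
move=> /(congr1 (fun mn : 'X_{1..#|mx_var n N|} => mn (row_var k0 x i))).
rewrite (sqfree_mnmE (@row_var_inj _ _)) iS sqfree_mnm_out //.
apply/codomP => -[j /row_var_eq[_ ki' _]].
by rewrite ki' eqxx in ki.
Qed.

(** A monomial of degree d leaves no room for entries of [v], so the original tensor reappears. *)
Lemma shifted_coord_coefT (l : image_coord d N m) x :
  (shifted_coord l)@_(sqfree_mnm (row_var k0 x) setT) = (l.2 == k0)%:R * t l.1 x.
Proof.
case: eqVneq => [lk|lk]; last first.
  rewrite mul0r; have [i ki] : exists i, l.2 i != k0 i.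
    apply/existsP; rewrite -negb_forall; apply: contra lk => /forallP lk.
    by apply/eqP/ffunP => i; apply/eqP.
  by apply: shifted_coord_coef0 ki; rewrite inE.
rewrite mul1r mcoeff_shifted_coord lk (bigD1 x) //= [X in _ + X]big1 ?addr0; last first.
  move=> y yx; apply: big1 => J _; case: eqP => [JT|_]; last by rewrite mulr0.
  have := congr1 mdeg JT; rewrite !mdeg_sqfree cardsT => cJ.
  have JT' : J = setT by apply/eqP; rewrite eqEcard subsetT cardsT cJ leqnn.
  case/eqP: yx; apply/ffunP => i.
  have := congr1 (fun mn : 'X_{1..#|mx_var n N|} => mn (row_var k0 y i)) JT.
  rewrite (sqfree_mnmE (@row_var_inj _ _)) JT' inE.
  have [/codomP[j /row_var_eq[]//]|hj] := boolP (row_var k0 y i \in codom (row_var k0 x)).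
  by rewrite sqfree_mnm_out.
rewrite (bigD1 setT) //= eqxx mulr1 setCT big_set0 mulr1 big1 ?addr0 // => J JT.
by rewrite (inj_eq (sqfree_mnm_inj (@row_var_inj _ _))) (negPf JT) mulr0.
Qed.

Definition agree_on (S : {set 'I_d}) (k : multi_index nN) := [forall i in S, k i == k0 i].

(** One prescribed index [i] in [S] already leaves only [d.-1] free indices. *)
Lemma card_agree_on S : S != set0 ->
  (#|[set l : image_coord d N m | agree_on S l.2]| <= m * N ^ d.-1)%N.
Proof.
move=> /set0Pn[i iS].
pose f (l : image_coord d N m) := (l.1, restrict (~: [set i]) l.2).
have f_inj : {in [set l : image_coord d N m | agree_on S l.2] &, injective f}.
  move=> [j k] [j' k']; rewrite !inE /= => /forall_inP kS /forall_inP kS' [-> kk].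
  congr (_, _); apply/ffunP => i'; have [->|ii'] := eqVneq i' i.
    by rewrite (eqP (kS i iS)) (eqP (kS' i iS)).
  have hi' : i' \in ~: [set i] by rewrite !inE.
  have := congr1 (fun r : sub_index nN (~: [set i]) => r (exist _ i' hi')) kk.
  by rewrite !ffunE.
rewrite -(card_in_imset f_inj); apply: leq_trans (max_card _) _.
rewrite card_prod card_ord card_sub_index cardsC1 card_ord.
by [].
Qed.

Lemma partition_terms_bound :
  (#|[set p : image_coord d N m * {set 'I_d} |
       [&& p.2 != set0, p.2 != setT & agree_on p.2 p.1.2]]| <= 2 ^ d * (m * N ^ d.-1))%N.
Proof.
rewrite -sum1_card (eq_bigl (fun p => [&& p.2 != set0, p.2 != setT & agree_on p.2 p.1.2]));
  last by move=> p; rewrite inE.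
rewrite -(pair_big_dep xpredT
  (fun l S => [&& S != set0, S != setT & agree_on S l.2]) (fun _ _ => 1%N)) /=.
rewrite (exchange_big_dep xpredT) //=.
rewrite -[X in (_ <= 2 ^ X * _)%N]card_ord -cardsT -card_powerset -sum_nat_const.
rewrite [leqRHS](eq_bigl predT) => [|S]; last by rewrite inE subsetT.
apply: leq_sum => S _; have [->|S0] := eqVneq S set0; first by rewrite big_pred0.
apply: leq_trans (card_agree_on S0); rewrite -sum1_card.
rewrite big_mkcond [leqRHS]big_mkcond; apply: leq_sum => l _; rewrite inE.
by case: (agree_on S l.2); rewrite ?andbF //; case: ifP.
Qed.

End RankBound.

(** Expand the relation at a point [v] where a derivative is nonzero and take the coefficient of the
    product of the variables [row_var k0 x]. It splits over the subsets [S] of variables taken from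
    [z]: the full set gives the combination, the empty set gives 0, and any other [S] gives products
    of a tensor on [S] and one on its complement, only for coordinates that agree with [k0] on
    [S]. *)
Theorem has_collective_expr_of_dependent d (n : 'I_d -> nat) (F : fieldType) N m
    (t : 'I_m -> tensor n F) b (s : seq F) :
  (0 < d)%N -> uniq s -> (d * b < size s)%N ->
  dependent (generic_image N (tuple_coords t)) b ->
  exists2 r, (r <= 2 ^ d * (m * N ^ d.-1))%N & has_collective_expr t r.
Proof.
move=> d0 uniq_s hs [h1 [h10 hb /(minimal_dependence h10)[h [i0 [hY hsize hder]]]]].
pose K := #|mx_var n N|.
have [v hv] : exists v : 'I_K -> F, (h^`M(i0) \mPo generic_image N (tuple_coords t)).@[v] != 0.
  apply: exists_meval_neq0 uniq_s _ hder; apply: leq_trans hs.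
  apply: leq_trans (msize_comp_le _ (msize_generic_image _)) _; rewrite ltnS leq_mul2l.
  apply/orP; right; apply: leq_trans (leq_trans hsize hb).
  apply: leq_trans (leq_pred _) (leq_trans (msize_mderiv_le _ _) (leq_pred _)).
(* The multi-index of the coordinate whose derivative is nonzero at [v]; this makes one entry of
   [cc] nonzero. *)
pose k0 := (enum_val i0).2.
pose lr : K.-tuple {mpoly F[K]} := [tuple 'X_i + (v i)%:MP | i < K].
have hlq l : tnth (generic_image N (tuple_coords t)) l \mPo lr
    = shifted_coord t v (enum_val l).
  rewrite tnth_mktuple rmorph_contract /=; apply: eq_contract => [i k x|x].
    by rewrite comp_mpolyXU -tnth_nth tnth_mktuple.
  by rewrite comp_mpolyC.
pose lq : #|image_coord d N m|.-tuple {mpoly F[K]} :=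
  [tuple shifted_coord t v (enum_val l) | l < #|image_coord d N m|].
have hlq0 : h \mPo lq = 0.
  have /(congr1 (comp_mpoly lr)) := hY; rewrite comp_mpolyA comp_mpoly0 => <-.
  by congr (_ \mPo _); apply: eq_from_tnth => l; rewrite [RHS]tnth_mktuple hlq tnth_mktuple.
have [q [hq q0]] := taylor2 lq h.
set c := fun i => _ in hq q0.
have cE l : c l = (tnth (generic_image N (tuple_coords t)) l).@[v].
  rewrite /c tnth_mktuple -hlq mcoeff0_comp; apply: meval_eq => i.
  by rewrite tnth_mktuple mcoeffD mcoeffC mcoeffX mnm1_eq0 add0r eqxx mulr1.
pose cc : 'rV[F]_m := \row_j (q (enum_rank (j, k0)))@_0%MM.
pose A := [set p : image_coord d N m * {set 'I_d} |
       [&& p.2 != set0, p.2 != setT & agree_on k0 p.2 p.1.2]].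
exists #|A|; first exact: partition_terms_bound.
exists cc; split.
  apply: contraNneq hv => /rowP/(_ (enum_val i0).1); rewrite !mxE q0.
  rewrite (_ : enum_rank _ = i0); last by rewrite -[RHS]enum_valK /k0; case: (enum_val i0).
  rewrite comp_mpoly_meval => <-; apply/eqP; apply: meval_eq => l.
  by rewrite -cE.
(* The monomial depends only on the restriction of [x] to [S], so the coefficients at [mn] form
   tensors on [S]. *)
pose mn (S : {set 'I_d}) (x : sub_index n S) : 'X_{1..K} :=
  (\sum_(i : {i | i \in S}) U_(enum_rank (@mx_entry d n N (val i) (k0 (val i)) (x i))))%MM.
have mnE S x : mn S (restrict S x) = sqfree_mnm (row_var k0 x) S.
  rewrite /sqfree_mnm (big_sub (mem S)) /=; apply: eq_bigr => i _.
  by rewrite ffunE.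
pose z l := shifted_coord t v l - ((shifted_coord t v l)@_0%MM)%:MP.
apply: (@has_partition_expr_set _ _ _ _ _ A (fun p => p.2)
  (fun p => [ffun x => - (z p.1)@_(mn p.2 x)])
  (fun p => [ffun x => (q (enum_rank p.1))@_(mn (~: p.2) x)])) => [p|].
  by rewrite inE => /and3P[].
apply/ffunP => x; rewrite !sum_ffunE.
under eq_bigr do rewrite !ffunE mxE.
under [RHS]eq_bigr do rewrite !ffunE !mnE.
pose G (l : image_coord d N m) (S : {set 'I_d}) := (z l)@_(sqfree_mnm (row_var k0 x) S)
  * (q (enum_rank l))@_(sqfree_mnm (row_var k0 x) (~: S)).
have z_coef l S : S != set0 ->
    (z l)@_(sqfree_mnm (row_var k0 x) S) = (shifted_coord t v l)@_(sqfree_mnm (row_var k0 x) S).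
  move=> S0; rewrite mcoeffB mcoeffC.
  by rewrite -mdeg_eq0 mdeg_sqfree cards_eq0 (negPf S0) mulr0 subr0.
have setT_neq0 : [set: 'I_d] != set0 by rewrite -cards_eq0 cardsT card_ord -lt0n.
(* The constant term of the expansion does not contribute, because the monomial has degree
   [d > 0]. *)
have tot : \sum_l \sum_S G l S = 0.
  have /(congr1 (mcoeff (sqfree_mnm (row_var k0 x) setT))) := hq.
  rewrite hlq0 mcoeff0 mcoeffD mcoeffC -mdeg_eq0 mdeg_sqfree cards_eq0.
  rewrite (negPf setT_neq0) mulr0 add0r raddf_sum /= => e; rewrite [RHS]e.
  rewrite [LHS](reindex _ (onW_bij _ (@enum_val_bij _))) /=; apply: eq_bigr => l _.
  by rewrite mcoeffM_sqfree ?tnth_mktuple /G ?enum_valK //; apply: row_var_inj.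
have G0 l S : S = set0 \/ ~~ agree_on k0 S l.2 -> G l S = 0.
  rewrite /G => -[->|]; first by rewrite sqfree_mnm0 mcoeffB mcoeffC eqxx mulr1 subrr mul0r.
  rewrite negb_forall => /existsP[i]; rewrite negb_imply => /andP[iS ki].
  rewrite z_coef ?(shifted_coord_coef0 _ _ _ iS ki) ?mul0r //.
  by apply/set0Pn; exists i.
(* Among the full sets, only the coordinates at [k0] remain, and they form the combination with
   coefficients [cc]. *)
have GT : \sum_l G l setT = \sum_j (q (enum_rank (j, k0)))@_0%MM * t j x.
  transitivity (\sum_j \sum_k G (j, k) setT); first by rewrite pair_bigA /=; apply: eq_bigr => -[].
  apply: eq_bigr => j _; rewrite (bigD1 k0) //= big1 ?addr0 => [|k kk].
    rewrite /G setCT sqfree_mnm0 z_coef // shifted_coord_coefT eqxx mul1r.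
    by rewrite mulrC.
  by rewrite /G z_coef // shifted_coord_coefT (negPf kk) !mul0r.
rewrite (eq_bigr (fun j => (q (enum_rank (j, k0)))@_0%MM * t j x)) => [|j _]; last by [].
rewrite -GT; apply/eqP; rewrite -subr_eq0; apply/eqP; rewrite -[RHS]tot.
rewrite [RHS](eq_bigr (fun l => G l setT + \sum_(S | S != setT) G l S)); last first.
  by move=> l _; rewrite (bigD1 setT).
rewrite big_split /=; congr (_ + _).
rewrite (pair_big_dep xpredT (fun _ S => S != setT)) /= -sumrN.
rewrite big_mkcond [RHS]big_mkcond; apply: eq_bigr => -[l S] _ /=.
rewrite inE /=; case: (S =P setT) => [_|_] /=; first by rewrite andbF.
case: eqVneq => [->|S0] /=; first by rewrite G0 //; left.
by case: (boolP (agree_on _ _ _)) => hS; [rewrite mulNr opprK|rewrite G0 //; right].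
Qed.

(** * Extension of scalars *)

Section ExtensionOfScalars.
Variables (K : fieldType) (L : fieldExtType K).
Let E := vbasis {:L}.

Lemma coordM i (u w : L) :
  coord E i (u * w) = \sum_(p < \dim {:L}) coord E p u * coord E i (E`_p * w).
Proof.
rewrite {1}(coord_vbasis (memvf u)) mulr_suml linear_sum; apply: eq_bigr => p _.
by rewrite -scalerAl linearZ.
Qed.

(** Apply a coordinate form of [L] over [K] that is nonzero on some coefficient. Expanding the left
    factor in the basis turns each product into [\dim {:L}] products over [K]. *)
Lemma has_collective_expr_descent d (n : 'I_d -> nat) m (t : 'I_m -> tensor n K) r :
  has_collective_expr (fun j => extend_scalars (in_alg L) (t j)) r ->
  has_collective_expr t (r * \dim {:L}).
Proof.
move=> [c [c0 [I [a [b [hI ht]]]]]]; have [l cl] := rowV_neq0P c0.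
have [i ci] : exists i, coord E i (c 0 l) != 0.
  apply/existsP; rewrite -negb_forall; apply: contra cl => /forallP ci.
  rewrite (coord_vbasis (memvf (c 0 l))) big1 // => i _.
  by rewrite (eqP (ci i)) scale0r.
exists (\row_j coord E i (c 0 j)); split.
  by apply: contraNneq ci => /rowP/(_ l); rewrite !mxE => ->.
have -> : (r * \dim {:L})%N = #|[set: 'I_r * 'I_(\dim {:L})]|.
  by rewrite cardsT card_prod !card_ord.
apply: (@has_partition_expr_set _ _ _ _ _ _ (fun p => I p.1)
  (fun p => [ffun x => coord E p.2 (a p.1 x)])
  (fun p => [ffun x => coord E i (E`_p.2 * b p.1 x)])) => [p _|]; first exact: hI.
apply/ffunP => x; have /(congr1 (fun u : tensor n L => coord E i (u x))) := ht.
rewrite !sum_ffunE !linear_sum /= => hx.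
transitivity (\sum_j coord E i ((c 0 j *: extend_scalars (in_alg L) (t j)) x)).
  apply: eq_bigr => j _; rewrite !ffunE mxE /=.
  have -> : c 0 j *: (in_alg L (t j x) : L^o) = t j x *: c 0 j.
    by rewrite /= -[LHS]/(c 0 j * (t j x)%:A) -scalerAr mulr1.
  by rewrite linearZ /= -[RHS]/(_ * _) mulrC.
pose G k p : K := coord E p (a k (restrict (I k) x))
  * coord E i (E`_p * b k (restrict (~: I k) x)).
have hG k : coord E i (tprod (a k) (b k) x) = \sum_(p < \dim {:L}) G k p.
  by rewrite ffunE coordM.
rewrite hx; transitivity (\sum_(k < r) \sum_(p < \dim {:L}) G k p); last first.
  by rewrite pair_bigA; apply: eq_big => [p|p _]; rewrite ?inE // !ffunE.
change (\sum_(k < r) coord E i (tprod (a k) (b k) x) = \sum_(k < r) \sum_(p < \dim {:L}) G k p).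
by apply: eq_bigr => k _; apply: hG.
Qed.

End ExtensionOfScalars.

(** For [a] outside the image of [x ^+ 2 - x], the polynomial [X^2 - X - a] has no root; this choice
    also covers characteristic 2. *)
Lemma exists_quadratic_ext (K : fieldType) (s : seq K) : (forall x, x \in s) ->
  {L : fieldExtType K | \dim {:L} = 2}.
Proof.
move=> hs; pose f (x : K) := x ^+ 2 - x.
(* f takes the value 0 at 0 and at 1, so it is not onto. *)
have [a ha] : {a : K | forall x, f x != a}.
  apply: constructive_indefinite_description; apply: contrapT => hf.
  have sub : {subset undup s <= map f (rem 1 (undup s))}.
    move=> a _; apply: contrapT => /negP/mapP ha; apply: hf; exists a => x.
    apply/eqP => fx; apply: ha; have [x1|x1] := eqVneq x 1.
      exists 0; last by rewrite -fx x1 /f expr1n subrr expr0n subr0.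
      by rewrite mem_rem_uniq ?undup_uniq // !inE mem_undup hs eq_sym oner_eq0.
    by exists x => //; rewrite mem_rem_uniq ?undup_uniq // !inE x1 mem_undup hs.
  have := uniq_leq_size (undup_uniq s) sub; rewrite size_map size_rem ?mem_undup ?hs //.
  by case: (undup s) (hs 1) (mem_undup s 1) => [-> //|y s' _ _]; rewrite ltnn.
pose p : {poly K} := 'X^2 - ('X + a%:P).
have szp : size p = 3.
  by rewrite size_polyDl ?size_polyXn // size_polyN size_XaddC.
have irr_p : irreducible_poly p.
  apply: cubic_irreducible => [|x]; first by rewrite szp.
  rewrite rootE !hornerE; apply: contra (ha x).
  by rewrite opprD addrA subr_eq0.
by have [L dimL _] := irredp_FAdjoin irr_p; exists L; rewrite dimL szp.
Qed.

Lemma finite_ext (K : fieldType) (L : fieldExtType K) (s : seq K) :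
  uniq s -> (forall x, x \in s) ->
  exists sL : seq L, [/\ uniq sL, forall y, y \in sL & size sL = (size s ^ \dim {:L})%N].
Proof.
move=> uniq_s hs.
pose f (g : {ffun 'I_(\dim {:L}) -> seq_sub s}) := \sum_i val (g i) *: (vbasis {:L})`_i.
have f_inj : injective f.
  move=> g h /(congr1 (fun y => coord (vbasis {:L}) ^~ y)) gh.
  apply/ffunP => i; apply: val_inj; have := congr1 (fun u => u i) gh.
  by rewrite /f !coord_sum_free ?(basis_free (vbasisP _)).
exists (map f (enum {ffun 'I_(\dim {:L}) -> seq_sub s})); split.
- by rewrite map_inj_uniq ?enum_uniq.
- move=> y; apply/mapP; exists [ffun i => SeqSub (hs (coord (vbasis {:L}) i y))].
    by rewrite mem_enum.
  by rewrite /f [LHS](coord_vbasis (memvf y)); apply: eq_bigr => i _; rewrite ffunE.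
- by rewrite size_map -cardE card_ffun card_ord card_seq_sub.
Qed.

Lemma extend_scalars_comp (K L E : fieldType) (f : {rmorphism K -> L})
    (g : {rmorphism L -> E}) d (n : 'I_d -> nat) (t : tensor n K) :
  extend_scalars (g \o f) t = extend_scalars g (extend_scalars f t).
Proof. by apply/ffunP => x; rewrite !ffunE. Qed.

(** A tower of quadratic extensions: each step squares the cardinality and doubles the number of
    products. *)
Lemma large_finite_ext j (K : fieldType) (s : seq K) : uniq s -> (forall x, x \in s) ->
  exists (L : fieldType) (f : {rmorphism K -> L}) (sL : seq L),
    [/\ uniq sL, size sL = (size s ^ (2 ^ j))%N
      & forall d (n : 'I_d -> nat) m (t : 'I_m -> tensor n K) r,
          has_collective_expr (fun i => extend_scalars f (t i)) r ->
          has_collective_expr t (r * 2 ^ j)].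
Proof.
elim: j K s => [|j IHj] K s uniq_s hs.
  exists K, idfun, s; split=> // d n m t r; rewrite muln1.
  rewrite (_ : (fun i => extend_scalars idfun (t i)) = t) //.
  by apply: funext => i; apply/ffunP => x; rewrite ffunE.
have [L dimL] := exists_quadratic_ext hs.
have [sL [uniq_sL hsL size_sL]] := finite_ext L uniq_s hs.
have [E [f [sE [uniq_sE size_sE hE]]]] := IHj L sL uniq_sL hsL.
exists E, (f \o in_alg L), sE; split=> // [|d n m t r].
  by rewrite size_sE size_sL dimL -expnM expnS.
have -> : (fun i => extend_scalars (f \o in_alg L) (t i))
    = (fun i => extend_scalars f (extend_scalars (in_alg L) (t i))).
  by apply: funext => i; apply: extend_scalars_comp.
move=> /hE /has_collective_expr_descent.
by rewrite dimL -mulnA -expnSr.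
Qed.

(** * Zariski closedness of dependence *)

(** Some maximal minor is nonzero; a choice [f] with repetitions has determinant 0 and does no
    harm. *)
Lemma row_freeP_minor (F : fieldType) p q (A : 'M[F]_(p, q)) :
  row_free A <-> exists f : 'I_p -> 'I_q, \det (rowsub f A^T) != 0.
Proof.
split=> [freeA|[f detf]].
  have fullA : row_full A^T by rewrite /row_full mxrank_tr.
  by exists (fullrankfun fullA); rewrite -unitfE -unitmxE fullrowsub_unit.
have : row_full A^T.
  rewrite -unitfE -unitmxE in detf; rewrite -col_leq_rank -{1}(mxrank_unit detf).
  by rewrite rowsubE mxrankM_maxr.
by rewrite /row_full mxrank_tr.
Qed.

Section Closedness.
Variables (T : finType) (X : forall F : fieldType, (T -> F) -> Prop).
Local Notation A := {mpoly int[#|T|]}.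

Definition zeval_rmorphism (F : fieldType) (v : T -> F) : {rmorphism A -> F} :=
  meval (fun k => v (enum_val k)) \o map_mpoly intr.

(** The tautological point, with values in the ring of integer polynomials. *)
Definition universal_point (x : T) : A := 'X_(enum_rank x).

Lemma zeval_universal_point (F : fieldType) (v : T -> F) :
  zeval_rmorphism v \o universal_point = v.
Proof.
by apply: funext => x; rewrite /= map_mpolyX mevalXU enum_rankK.
Qed.

(** The maximal minors of [G] are integer polynomials that vanish on [X], hence on its closure. *)
Lemma closure_not_row_free p q (G : 'M[A]_(p, q)) (F : fieldType) (v : T -> F) :
  (forall (E : fieldType) (w : T -> E), X w -> ~~ row_free (map_mx (zeval_rmorphism w) G)) ->
  in_zariski_closure X v -> ~~ row_free (map_mx (zeval_rmorphism v) G).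
Proof.
pose S (f : A) := exists g : 'I_p -> 'I_q, f = \det (rowsub g G^T).
have minorE (E : fieldType) (w : T -> E) g :
    zeval w (\det (rowsub g G^T)) = \det (rowsub g (map_mx (zeval_rmorphism w) G)^T).
  by rewrite -[LHS]/(zeval_rmorphism w _) -det_map_mx map_mxsub map_trmx.
move=> hX /(_ S) hv; apply/negP => /row_freeP_minor[g]; rewrite -minorE => /eqP; apply.
apply: hv; last by exists g.
move=> E w /hX hw _ [f ->]; rewrite minorE; apply/eqP; apply: contraNT hw => hw.
by apply/row_freeP_minor; exists f.
Qed.

End Closedness.

(** The dependence matrices over all fields are specializations of a single matrix of integer
    polynomials. *)
Lemma generic_image_zeval (d : nat) (n : 'I_d -> nat) N m b (F : fieldType)
    (w : 'I_m * multi_index n -> F) :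
  map_mx (zeval_rmorphism w)
    (dependence_mx d b (generic_image N (@universal_point ('I_m * multi_index n)%type)))
  = dependence_mx d b (generic_image N w).
Proof. by rewrite map_dependence_mx map_generic_image zeval_universal_point. Qed.

Lemma dependent_closure (d : nat) (n : 'I_d -> nat) N m b
    (X : forall F : fieldType, ('I_m * multi_index n -> F) -> Prop)
    (F : fieldType) (v : 'I_m * multi_index n -> F) :
  (forall (E : fieldType) (w : 'I_m * multi_index n -> E),
     X E w -> dependent (generic_image N w) b) ->
  in_zariski_closure X v -> dependent (generic_image N v) b.
Proof.
move=> hX hv; apply/(dependentP _ (msize_generic_image v)); rewrite -generic_image_zeval.
apply: (closure_not_row_free _ hv) => E w /hX hw; rewrite generic_image_zeval.
exact/(dependentP _ (msize_generic_image w)).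
Qed.

Lemma dependent_extend_scalars (d : nat) (n : 'I_d -> nat) N m b (K L : fieldType)
    (f : {rmorphism K -> L}) (w : 'I_m * multi_index n -> K) :
  dependent (generic_image N (f \o w)) b -> dependent (generic_image N w) b.
Proof.
move=> /(dependentP _ (msize_generic_image (f \o w))).
rewrite -map_generic_image -map_dependence_mx row_free_map.
by move=> /(dependentP _ (msize_generic_image w)).
Qed.

Definition flattening (R : Type) (T U : finType) (w : T * U -> R) :=
  \matrix_(i < #|T|, j < #|U|) w (enum_val i, enum_val j).

(** Rank 0 is linear dependence of the tensors, again a rank condition. It is treated apart since
    the final bound is 0 for [r = 0] and [d > 1]. *)
Lemma has_collective_expr0 d (n : 'I_d -> nat) (F : fieldType) m (t : 'I_m -> tensor n F) :
  has_collective_expr t 0 <-> ~~ row_free (flattening (tuple_coords t)).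
Proof.
rewrite not_row_freeP; split=> [[c [c0 [I [a [b [_ ht]]]]]]|[c c0 ct]].
  exists (\row_i c 0 (enum_val i)).
    have [i ci] := rowV_neq0P c0; apply: contraNneq ci => /rowP/(_ (enum_rank i)).
    by rewrite !mxE enum_rankK => ->.
  apply/rowP => j; rewrite !mxE; have /(congr1 (fun u : tensor n F => u (enum_val j))) := ht.
  rewrite big_ord0 sum_ffunE ffunE => h; rewrite -[RHS]h.
  rewrite [RHS](reindex _ (onW_bij _ (@enum_val_bij _))) /=; apply: eq_bigr => i _.
  by rewrite !mxE ffunE.
exists (\row_i c 0 (enum_rank i)); split.
  have [i ci] := rowV_neq0P c0; apply: contraNneq ci => /rowP/(_ (enum_val i)).
  by rewrite !mxE enum_valK => ->.
exists (fun _ => set0), (fun _ => 0), (fun _ => 0); split=> [[]//|].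
rewrite big_ord0; apply/ffunP => x; have /rowP/(_ (enum_rank x)) := ct.
rewrite !mxE sum_ffunE ffunE => h; rewrite -[RHS]h.
rewrite [LHS](reindex _ (onW_bij _ (@enum_val_bij _))) /=; apply: eq_bigr => i _.
by rewrite ffunE !mxE /tuple_coords /= enum_valK enum_rankK.
Qed.

Lemma map_flattening (R S : Type) (f : R -> S) (T U : finType) (w : T * U -> R) :
  map_mx f (flattening w) = flattening (f \o w).
Proof. by apply/matrixP => i j; rewrite !mxE. Qed.

(** If [g] is invertible, the last row of its inverse recovers the sum of products. If not, a vector
    of the left kernel gives the combination 0, written with zero factors. *)
Lemma border_image_has_expr d (n : 'I_d -> nat) m r (I : 'I_r -> {set 'I_d})
    (F : fieldType) (w : 'I_m * multi_index n -> F) :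
  (0 < m)%N -> (forall k, proper_nonempty (I k)) -> border_image I w ->
  exists2 t : 'I_m -> tensor n F, w = tuple_coords t & has_collective_expr t r.
Proof.
case: m w => // m w _ hI [g [u [a [b ->]]]]; set s := \sum_(k < r) _.
exists (mx_act g (append_last u s)) => //.
have act_sum (c : 'rV_m.+1) : \sum_i c 0 i *: mx_act g (append_last u s) i
    = \sum_j (c *m g) 0 j *: append_last u s j.
  under eq_bigr do rewrite scaler_sumr; rewrite exchange_big /=; apply: eq_bigr => j _.
  by rewrite mxE scaler_suml; apply: eq_bigr => i _; rewrite scalerA.
have [gU|gN] := boolP (g \in unitmx).
  exists (row ord_max (invmx g)); split.
    apply/negP => /eqP c0.
    have : delta_mx 0 ord_max *m invmx g *m g = 0 :> 'rV_m.+1 by rewrite -rowE c0 mul0mx.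
    rewrite mulmxKV // => /rowP/(_ ord_max); rewrite !mxE !eqxx => /eqP.
    by rewrite oner_eq0.
  exists I, a, b; split=> //; rewrite act_sum -row_mul mulVmx // (bigD1 ord_max) //=.
  rewrite !mxE eqxx scale1r big1 ?addr0 => [|j jm].
    by rewrite /append_last insubN //= -leqNgt.
  by rewrite !mxE eq_sym (negPf jm) scale0r.
have [c c0 cg] : exists2 c : 'rV_m.+1, c != 0 & c *m g = 0.
  by apply/not_row_freeP; rewrite row_free_unit.
exists c; split=> //; exists I, (fun _ => 0), b; split=> //.
rewrite act_sum cg big1 => [|j _]; last by rewrite mxE scale0r.
by rewrite big1 // => k _; apply/ffunP => x; rewrite !ffunE mul0r.
Qed.

(** * Choice of parameters *)

Definition enough_monomials (d m r N B : nat) : Prop :=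
  ((2 * (m * N ^ d) * B) ^ (m + m.-1 * N ^ d + 2 * (r * N ^ d.-1)) < B ^ (m * N ^ d))%N.

(** [s] is the d-th root of [4 * m] rounded up. Thus [N] can be of order [r * s], and [N ^ d.-1]
    costs only one factor [m]. *)
Lemma exists_root_bound d m : (0 < d)%N -> (0 < m)%N ->
  exists s, [/\ (0 < s)%N, (s <= 4 * m)%N, (4 * m <= s ^ d)%N
    & (s ^ d.-1 <= 2 ^ d.-1 * (4 * m))%N].
Proof.
move=> d0 m0; have ex : exists s, (4 * m <= s ^ d)%N.
  exists (4 * m)%N; rewrite -{1}[(4 * m)%N]expn1 leq_pexp2l //.
  by rewrite muln_gt0.
case: (ex_minnP ex) => -[|[|s]] hs smin.
- by move: hs; rewrite exp0n // leqn0 muln_eq0 /= => /eqP m_0; rewrite m_0 in m0.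
- by move: hs; rewrite exp1n; lia.
have s_lt : (s.+1 ^ d < 4 * m)%N.
  by rewrite ltnNge; apply/negP => /smin; rewrite ltnn.
have s_le : (s.+1 <= s.+1 ^ d)%N by have := @leq_pexp2l s.+1 1 d isT d0; rewrite expn1.
exists s.+2; split=> //; first exact: leq_ltn_trans s_le s_lt.
apply: (@leq_trans ((2 * s.+1) ^ d.-1)%N); first
  by case: (d.-1) => [|e]; rewrite ?expn0 ?leq_exp2r //; lia.
rewrite expnMn leq_mul2l; apply/orP; right; apply: leq_trans (ltnW s_lt).
by rewrite leq_pexp2l // leq_pred.
Qed.

Lemma exists_parameters d m r : (0 < d)%N -> (0 < m)%N -> (0 < r)%N ->
  exists N B, [/\ (0 < N)%N, enough_monomials d m r N B,
    (N ^ d.-1 <= 4 * 16 ^ d.-1 * m * r ^ d.-1)%N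
    & (d * (m * N ^ d * B) <= (r + m) ^ (30 * d * m))%N].
Proof.
move=> d0 m0 r0; have [s [s0 s_le s_pow s_pow']] := exists_root_bound d0 m0.
(* The factor [8 * r] gives [8 * r * N ^ d.-1 <= N ^ d] and the factor [s] gives [4 * m <= N ^ d];
   together the parameters fall short of the coordinates by at least half of [N ^ d]. *)
pose N := (8 * r * s)%N; have N0 : (0 < N)%N by rewrite !muln_gt0 r0 s0.
pose M := (m * N ^ d)%N; have M0 : (0 < M)%N by rewrite muln_gt0 m0 expn_gt0 N0.
(* The condition reduces to [(2 * M) ^ P < B ^ (M - P)], which holds since
   [2 * m * (M - P) >= M > P]. *)
pose B := ((2 * M) ^ (2 * m))%N.
have B0 : (0 < B)%N by rewrite expn_gt0 muln_gt0 M0.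
have hNd : (N ^ d = N * N ^ d.-1)%N by rewrite -expnS prednK.
have h4 : (4 * m <= N ^ d)%N.
  apply: leq_trans s_pow _; rewrite leq_exp2r // -{1}[s]mul1n leq_mul2r.
  by rewrite muln_gt0 r0 orbT.
have h8 : (8 * (r * N ^ d.-1) <= N ^ d)%N.
  rewrite hNd mulnA leq_mul2r; apply/orP; right.
  by rewrite -[X in (X <= _)%N]muln1 leq_mul2l s0 orbT.
set P := (m + m.-1 * N ^ d + 2 * (r * N ^ d.-1))%N.
have hP : (2 * P + N ^ d <= 2 * M)%N.
  rewrite /P /M; move: h4 h8; set a := (N ^ d)%N; set b := (r * _)%N.
  have -> : (m * a = a + m.-1 * a)%N by rewrite -mulSn prednK.
  lia.
have PM : (P <= M)%N by lia.
exists N, B; split=> //.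
- rewrite /enough_monomials -/M -/P.
  have -> : (B ^ M = B ^ (M - P) * B ^ P)%N by rewrite -expnD subnK.
  rewrite expnMn ltn_pmul2r; last by rewrite expn_gt0 B0.
  rewrite /B -expnM ltn_exp2l; last by lia.
  have : (m * N ^ d <= 2 * m * (M - P))%N.
    by rewrite mulnAC mulnC leq_mul2r; apply/orP; right; lia.
  rewrite -/M; have : (0 < N ^ d)%N by rewrite expn_gt0 N0.
  lia.
- rewrite /N !expnMn; apply: (@leq_trans (8 ^ d.-1 * r ^ d.-1 * (2 ^ d.-1 * (4 * m)))%N).
    by rewrite leq_mul2l s_pow' orbT.
  by rewrite (_ : 16 = 8 * 2)%N // expnMn; apply/eq_leq; lia.
(* All quantities are bounded by powers of [q >= 2]. The logarithm of the degree is linear in [m],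
   the source of the third factor [m] in the final bound. *)
- set q := (r + m)%N; have q2 : (2 <= q)%N by rewrite /q; lia.
  have q_le a b : (a <= b)%N -> (q ^ a <= q ^ b)%N by move=> ab; rewrite leq_pexp2l // ltnW.
  have two_le a : (2 ^ a <= q ^ a)%N by case: a => // a; rewrite leq_exp2r.
  have N_le : (N <= q ^ 7)%N.
    apply: (@leq_trans (2 ^ 5 * (q ^ 2))%N); last first.
      by rewrite (expnD q 5 2) leq_mul2r two_le orbT.
    apply: (@leq_trans (8 * r * (4 * m))%N); first by rewrite leq_mul2l s_le orbT.
    rewrite mulnACA leq_mul2l; apply/orP; right; rewrite -mulnn.
    by apply: leq_mul; [apply: leq_addr|apply: leq_addl].
  have d_le : (d <= q ^ d)%N by apply: leq_trans (ltnW (ltn_expl d (isT : 1 < 2)%N)) (two_le d).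
  have m_le : (m <= q ^ 1)%N by rewrite expn1 leq_addl.
  have M_le : (2 * M <= q ^ (9 * d))%N.
    apply: (@leq_trans (q ^ 1 * (q ^ 1 * (q ^ 7) ^ d))%N).
      apply: leq_mul; first by rewrite expn1.
      by apply: leq_mul; rewrite ?leq_exp2r.
    by rewrite -expnM -!expnD q_le //; lia.
  apply: (@leq_trans (q ^ d * (q ^ (9 * d) * (q ^ (9 * d)) ^ (2 * m)))%N).
    apply: leq_mul => //; apply: leq_mul; first by apply: leq_trans M_le; rewrite leq_pmull.
    by rewrite leq_exp2r // muln_gt0.
  have dm : (d <= d * m)%N by rewrite leq_pmulr.
  by rewrite -expnM -!expnD q_le //; lia.
Qed.

(** * Bounds on the collective partition rank *)

Lemma min_nat_le (P : nat -> Prop) r : P r -> exists k, min_nat P = Some k /\ (k <= r)%N.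
Proof.
move=> Pr; rewrite /min_nat; case: pselect => [exP|]; last first.
  by case; exists r; apply/asboolP.
by exists (ex_minn exP); split=> //; case: ex_minnP => k _; apply; apply/asboolP.
Qed.

Lemma min_natP (P : nat -> Prop) r : min_nat P = Some r -> P r.
Proof.
rewrite /min_nat; case: pselect => // exP [<-].
by case: ex_minnP => k /asboolP.
Qed.

Section CollectiveRank.
Variables (d : nat) (n : 'I_d -> nat) (K : fieldType) (m : nat) (t : 'I_m -> tensor n K).

Lemma collective_prk_le r : has_collective_expr t r ->
  exists k, collective_prk t = Some k /\ (k <= r)%N.
Proof.
move=> [c [c0 /min_nat_le[k [hk kr]]]].
have [|k' [hk' k'k]] := @min_nat_le (fun r => exists c : 'rV[K]_m,
    c != 0 /\ prk (\sum_(i < m) c 0 i *: t i) = Some r) k; first by exists c.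
by exists k'; split=> //; apply: leq_trans kr.
Qed.

Lemma collective_prk_expr r : collective_prk t = Some r -> has_collective_expr t r.
Proof. by move=> /min_natP[c [c0 /min_natP hc]]; exists c. Qed.

(* The consequences of "collective partition rank at most r" that survive in the
   limit and under field extensions. *)
Definition limit_low_rank (r : nat) : Prop :=
  (r = 0%N -> has_collective_expr t 0) /\
  forall N B, (0 < N)%N -> enough_monomials d m r N B ->
    dependent (generic_image N (tuple_coords t)) (m * N ^ d * B).

Lemma border_prk_limit r : (0 < m)%N -> border_prk t = Some r -> limit_low_rank r.
Proof.
move=> m0 /min_natP[I [hI ht]]; split=> [r0|N B N0 hB].
  apply/has_collective_expr0.
  have hflat (E : fieldType) (w : 'I_m * multi_index n -> E) :
      map_mx (zeval_rmorphism w) (flattening (@universal_point ('I_m * multi_index n)%type))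
      = flattening w by rewrite map_flattening zeval_universal_point.
  rewrite -hflat; apply: (closure_not_row_free _ ht) => E w hw; rewrite hflat.
  have [t' -> ht'] := border_image_has_expr m0 hI hw.
  by apply/has_collective_expr0; rewrite -[X in has_collective_expr _ X]r0.
apply: (dependent_closure _ ht) => E w hw.
have [t' -> ht'] := border_image_has_expr m0 hI hw.
exact: dependent_low_rank ht' hB.
Qed.

Lemma extend_scalars_limit (L : fieldType) (f : {rmorphism K -> L}) r : (0 < m)%N ->
  has_collective_expr (fun i => extend_scalars f (t i)) r -> limit_low_rank r.
Proof.
have ext_coords : tuple_coords (fun i => extend_scalars f (t i)) = f \o tuple_coords t.
  by apply: funext => -[i x]; rewrite /tuple_coords /= ffunE.
move=> m0 ht; split=> [r0|N B N0 hB].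
  move: ht; rewrite r0 => /has_collective_expr0.
  by rewrite ext_coords -map_flattening row_free_map => /has_collective_expr0.
apply: (@dependent_extend_scalars _ _ _ _ _ _ _ f).
by rewrite -ext_coords; apply: dependent_low_rank ht hB.
Qed.

End CollectiveRank.

(** This is [2 ^ d * (m * N ^ d.-1)] with [N ^ d.-1] replaced by its bound from
    [exists_parameters]. *)
Definition rank_constant d m r := (2 ^ d * (m * (4 * 16 ^ d.-1 * m * r ^ d.-1)))%N.

Section Bounds.
Variables (d : nat) (n : 'I_d -> nat) (K : fieldType) (m : nat) (t : 'I_m -> tensor n K).
Variable r : nat.
Hypotheses (d0 : (0 < d)%N) (m0 : (0 < m)%N) (ht : limit_low_rank t r).

Lemma infinite_field_bound : (forall s : seq K, exists x, x \notin s) -> (0 < r)%N ->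
  exists k, collective_prk t = Some k /\ (k <= rank_constant d m r)%N.
Proof.
move=> hK r0; have [N [B [N0 hB N_le _]]] := exists_parameters d0 m0 r0.
have [s [uniq_s size_s]] : exists s : seq K, uniq s /\ size s = (d * (m * N ^ d * B)).+1.
  elim: (_.+1) => [|j [s [uniq_s size_s]]]; first by exists [::].
  by have [x xs] := hK s; exists (x :: s); rewrite /= xs uniq_s size_s.
have [|k k_le hk] := has_collective_expr_of_dependent d0 uniq_s _ (ht.2 N B N0 hB).
  by rewrite size_s.
have [k' [hk' k'_le]] := collective_prk_le hk; exists k'; split=> //.
by apply: leq_trans k'_le (leq_trans k_le _); rewrite leq_mul2l leq_mul2l N_le !orbT.
Qed.

Lemma finite_field_bound (s : seq K) : (forall x, x \in s) -> (0 < r)%N ->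
  exists k u, [/\ collective_prk t = Some k,
    (k <= rank_constant d m r * (2 * u.+1))%N & (2 ^ u <= (r + m) ^ (30 * d * m))%N].
Proof.
move=> hs r0; have [N [B [N0 hB N_le D_le]]] := exists_parameters d0 m0 r0.
pose D := (d * (m * N ^ d * B))%N; pose u := trunc_log 2 D.
(* Then [u + 1 < 2 ^ j <= 2 * (u + 1)]: the extension of degree [2 ^ j] has more than [D] elements,
   and the rank grows by a factor of at most [2 * (u + 1)]. *)
pose j := (trunc_log 2 u.+1).+1.
have /andP[j_le u_lt] := trunc_log_bounds (isT : 1 < 2)%N (ltn0Sn u).
have [D_lt u_le] : (D < 2 ^ u.+1)%N /\ (2 ^ u <= (r + m) ^ (30 * d * m))%N.
  rewrite /u; have [->|D0] := posnP D.
    by rewrite trunc_log0; split=> //; rewrite expn0 expn_gt0 addn_gt0 r0.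
  have /andP[uD Du] := trunc_log_bounds (isT : 1 < 2)%N D0.
  by split=> //; apply: leq_trans uD D_le.
have us := undup_uniq s; have hus x : x \in undup s by rewrite mem_undup.
have [L [f [sL [uniq_sL size_sL hL]]]] := large_finite_ext j us hus.
have size_s : (1 < size (undup s))%N.
  apply: (@uniq_leq_size _ [:: 0; 1]) => [|x _]; last exact: hus.
  by rewrite /= inE eq_sym oner_eq0.
have sL_gt : (D < size sL)%N.
  rewrite size_sL; apply: leq_trans D_lt _.
  apply: (@leq_trans (2 ^ (2 ^ j))%N); first by rewrite leq_pexp2l // ltnW.
  by rewrite leq_exp2r // expn_gt0.
have dep : dependent (generic_image N (tuple_coords (fun i => extend_scalars f (t i))))
    (m * N ^ d * B).
  apply/(dependentP _ (msize_generic_image _)); move: (ht.2 N B N0 hB).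
  move/(dependentP _ (msize_generic_image _)); rewrite -(row_free_map f).
  rewrite map_dependence_mx map_generic_image (_ : f \o tuple_coords t
    = tuple_coords (fun i => extend_scalars f (t i))) //.
  by apply: funext => -[i x]; rewrite /tuple_coords /= ffunE.
have [k k_le hk] := has_collective_expr_of_dependent d0 uniq_sL sL_gt dep.
have [k' [hk' k'_le]] := collective_prk_le (hL _ _ _ _ _ hk).
exists k', u; split=> //; apply: leq_trans k'_le _; apply: leq_mul.
  by apply: leq_trans k_le _; rewrite leq_mul2l leq_mul2l N_le !orbT.
by rewrite /j expnS leq_mul2l j_le.
Qed.

End Bounds.

From mathcomp Require Import classical_sets cardinality reals exp lra.
Import Order.TTheory.

(** * Bounds with real constants and logarithms *)

Section RealBounds.
Variables (R : realType) (d : nat) (hd : (0 < d)%N).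
(** The factor [62 * d] absorbs the degree of the field extension: with [l] the binary logarithm of
    [r + m], [u <= 30 * d * m * l] and [d * m * l >= 1] give [2 * (u + 1) <= 62 * d * m * l]. *)
Let C : R := (2 ^ d * (4 * 16 ^ d.-1) * (62 * d))%:R.

Lemma rank_constant_le m r :
  (rank_constant d m r)%:R * (62 * d * m)%:R = C * m%:R ^+ 3 * r%:R ^+ d.-1.
Proof.
rewrite /rank_constant /C -!natrX -!natrM; congr (_%:R).
rewrite !expnS expn0; nia.
Qed.

Lemma log2_ge1 q : (2 <= q)%N -> 1 <= ln q%:R / ln 2 :> R.
Proof.
move=> q2; have ln2 : 0 < ln 2 :> R by rewrite ln_gt0 // ltr1n.
by rewrite ler_pdivlMr // mul1r ler_ln ?posrE ?ltr0n ?ler_nat //; apply: ltnW.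
Qed.

Lemma log2_le q u e : (0 < q)%N -> (2 ^ u <= q ^ e)%N -> u%:R <= e%:R * (ln q%:R / ln 2) :> R.
Proof.
move=> q0 uq; have ln2 : 0 < ln 2 :> R by rewrite ln_gt0 // ltr1n.
rewrite mulrA ler_pdivlMr // !mulr_natl -!lnXn ?ltr0n // -!natrX.
by rewrite ler_ln ?posrE ?ltr0n ?expn_gt0 ?q0 // ler_nat.
Qed.

Lemma collective_prk_bounds (K : fieldType) (m : nat) (n : 'I_d -> nat)
    (t : 'I_m -> tensor n K) (r : nat) :
  (0 < m)%N -> limit_low_rank t r ->
  (infinite_set [set: K]%classic ->
    exists k : nat, collective_prk t = Some k /\ k%:R <= C * m%:R ^+ 3 * r%:R ^+ d.-1) /\
  (finite_set [set: K]%classic ->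
    exists k : nat, collective_prk t = Some k /\
      k%:R <= C * m%:R ^+ 3 * r%:R ^+ d.-1 * (ln (r + m)%:R / ln 2)).
Proof.
move=> m0 ht.
have log_ge0 q : (0 < q)%N -> 0 <= ln q%:R / ln 2 :> R.
  by move=> q0; rewrite divr_ge0 // ln_ge0 // ler1n.
have C0 : 0 <= C by rewrite ler0n.
have [r_0|r0] := posnP r.
  have [k [hk]] := collective_prk_le (ht.1 r_0); rewrite leqn0 => /eqP k0.
  split=> _; exists k; split=> //; rewrite k0 !mulr_ge0 ?exprn_ge0 ?ler0n // ?invr_ge0.
    by rewrite ln_ge0 // ler1n addn_gt0 m0 orbT.
  by rewrite ln_ge0 // ler1n.
have q2 : (2 <= r + m)%N by lia.
have q0 : (0 < r + m)%N by lia.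
rewrite -rank_constant_le; split=> hK.
  have [s|k [hk k_le]] := infinite_field_bound hd m0 ht _ r0.
    apply: contrapT => hs; apply: hK; apply/finite_seqP; exists s.
    by apply/seteqP; split=> // x _ /=; apply: contrapT => /negP xs; apply: hs; exists x.
  exists k; split=> //; rewrite -natrM ler_nat; apply: leq_trans k_le _.
  by rewrite leq_pmulr // !muln_gt0 hd m0.
have /finite_seqP[s hs] := hK.
have hs' x : x \in s by have : [set` s]%classic x by rewrite -hs.
have [k [u [hk k_le u_le]]] := finite_field_bound hd m0 ht hs' r0.
exists k; split=> //; apply: (@le_trans _ _ (rank_constant d m r * (2 * u.+1))%:R).
  by rewrite ler_nat.
rewrite natrM -mulrA ler_wpM2l ?ler0n //.
have := log2_le q0 u_le; have := log2_ge1 q2; set l := _ / _ => l1 ul.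
have dm1 : 1 <= (d * m)%:R :> R by rewrite ler1n muln_gt0 hd.
move: ul; rewrite -!mulnA !natrM -natr1 -[(d%:R * m%:R)]natrM; set e := (d * m)%:R in dm1 *.
nra.
Qed.

End RealBounds.

Local Open Scope classical_set_scope.

Theorem theorem1p16 (R : realType) (d : nat) (hd : (1 <= d)%N) :
  (exists C : R, 0 < C /\
    forall (K : fieldType) (m : nat) (n : 'I_d -> nat)
           (t : 'I_m -> tensor n K) (r : nat),
      (1 <= m)%N -> border_prk t = Some r ->
      (infinite_set [set: K] ->
        exists k : nat, collective_prk t = Some k /\
          k%:R <= C * m%:R ^+ 3 * r%:R ^+ d.-1) /\
      (finite_set [set: K] ->
        exists k : nat, collective_prk t = Some k /\
          k%:R <= C * m%:R ^+ 3 * r%:R ^+ d.-1 * (ln (r + m)%:R / ln 2)))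
  /\
  (exists P : {mpoly R[2]},
    forall (K : fieldType) (L : closedFieldType) (iota : {rmorphism K -> L}),
      is_algebraic_closure iota ->
      forall (m : nat) (n : 'I_d -> nat) (t : 'I_m -> tensor n K) (s : nat),
        (1 <= m)%N ->
        collective_prk (fun i => extend_scalars iota (t i)) = Some s ->
        exists k : nat, collective_prk t = Some k /\
          k%:R <= P.@[fun i : 'I_2 => if i == 0 then m%:R else s%:R]).
Proof.
pose C : R := (2 ^ d * (4 * 16 ^ d.-1) * (62 * d))%:R.
have C_gt0 : 0 < C by rewrite ltr0n !muln_gt0 !expn_gt0 hd.
split.
  exists C; split=> // K m n t r m0 hr.
  exact: (collective_prk_bounds R hd m0 (border_prk_limit m0 hr)).
(* The last factor replaces the logarithm of [s + m], which is at most [s + m]; over infinite fields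
   it is just a factor of at least 1. *)
pose P : {mpoly R[2]} := C%:MP * 'X_0 ^+ 3 * 'X_1 ^+ d.-1 * ('X_1 + 'X_0).
exists P => K L iota _ m n t s m0 /collective_prk_expr ht.
have [hinf hfin] := collective_prk_bounds R hd m0 (extend_scalars_limit m0 ht).
rewrite /P !mevalM mevalD !rmorphXn /= !mevalXU mevalC /=.
rewrite -natrD.
have A0 : 0 <= C * m%:R ^+ 3 * s%:R ^+ d.-1 by rewrite !mulr_ge0 ?exprn_ge0 ?ler0n // ltW.
have sm1 : (0 < s + m)%N by rewrite addn_gt0 m0 orbT.
have [/hfin|/hinf] := EM (finite_set [set: K]); move=> [k [hk k_le]]; exists k; split=> //;
  apply: le_trans k_le _.
  rewrite ler_wpM2l // ler_pdivrMr ?ln_gt0 ?ltr1n // mulr_natl -lnXn ?ltr0n // -natrX.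
  by rewrite ler_ln ?posrE ?ltr0n ?expn_gt0 // ler_nat ltnW // ltn_expl.
by rewrite ler_peMr // ler1n.
Qed.
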